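(* Let $\mathscr{C}$ be a strict rigid category. Then there is a bijection between (i) equivalence classes of quasi-pivotal structures on $\mathscr{C}$, (ii) the Picard heap $\mathrm{Pic}\,\mathsf{A}(\mathscr{C})$ of the anti-Drinfeld centre $\mathsf{A}(\mathscr{C})$, and (iii) isomorphism classes of equivalences of left $\mathsf{Z}(\mathscr{C})$-module categories between $\mathsf{Z}(\mathscr{C})$ and $\mathsf{A}(\mathscr{C})$.
   Context: A strict rigid category is a strict monoidal category in which every object $x$ has a left dual ${}^\vee x$ (with $\mathrm{ev}_x\colon {}^\vee x\otimes x\to1$, $\mathrm{coev}_x\colon1\to x\otimes{}^\vee x$) and a right dual $x^\vee$, such that the dualising functors ${}^\vee(-),(-)^\vee\colon\mathscr{C}^{\mathrm{op},\mathrm{rev}}\to\mathscr{C}$ are strict monoidal and ${}^\vee((-)^\vee)=\mathrm{Id}=({}^\vee(-))^\vee$. An object is invertible if its left evaluation and coevaluation are isomorphisms. A quasi-pivotal structure on $\mathscr{C}$ is a pair $(\beta,\rho_\beta)$ of an invertible object $\beta\in\mathscr{C}$ and a monoidal natural isomorphism $\rho_\beta\colon\mathrm{Id}_{\mathscr{C}}\Rightarrow\beta\otimes{}^{\vee\vee}(-)\otimes{}^\vee\beta$. If $\phi\colon\beta'\to\beta$ is an isomorphism, then $(\beta,\rho_\beta)$ is declared equivalent to $(\beta',(\phi^{-1}\otimes\mathrm{id}\otimes{}^\vee\phi)\circ\rho_\beta)$. $\mathsf{Z}(\mathscr{C})$ is the Drinfeld centre: objects $(x,\sigma_{x,-})$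 with a natural isomorphism $\sigma_{x,y}\colon x\otimes y\to y\otimes x$ with $\sigma_{x,1}=\mathrm{id}$, $\sigma_{x,y\otimes z}=(\mathrm{id}_y\otimes\sigma_{x,z})(\sigma_{x,y}\otimes\mathrm{id}_z)$. The anti-Drinfeld centre $\mathsf{A}(\mathscr{C})$ has as objects pairs $(a,\sigma_{a,-})$ with $a\in\mathscr{C}$ and a natural isomorphism $\sigma_{a,y}\colon a\otimes{}^{\vee\vee}y\to y\otimes a$ satisfying $\sigma_{a,1}=\mathrm{id}_a$ and $\sigma_{a,y\otimes z}=(\mathrm{id}_y\otimes\sigma_{a,z})(\sigma_{a,y}\otimes\mathrm{id}_{{}^{\vee\vee}z})$; morphisms are morphisms of $\mathscr{C}$ commuting with the half-braidings. $\mathsf{Z}(\mathscr{C})$ acts on $\mathsf{A}(\mathscr{C})$ from the left by $x\otimes a$ with half-braiding $\sigma_{x\otimes a,y}=(\sigma_{x,y}\otimes\mathrm{id}_a)(\mathrm{id}_x\otimes\sigma_{a,y})$. The Picard heap $\mathrm{Pic}\,\mathsf{A}(\mathscr{C})$ is the set of isomorphism classes (in $\mathsf{A}(\mathscr{C})$) of objects $(\alpha,\sigma_{\alpha,-})\in\mathsf{A}(\mathscr{C})$ whose underlying object $\alpha\in\mathscr{C}$ is invertible, with heap operation $\langle[\alpha],[\beta],[\gamma]\rangle=[\alpha\otimes{}^\vee\beta\otimes\gamma]$. *)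

(* Defs.v *)
From mathcomp Require Import all_boot boolp classical_sets.
From Stdlib Require Import RelationClasses.

Set Implicit Arguments.
Unset Strict Implicit.
Unset Printing Implicit Defensive.

Declare Scope cat_scope.
Delimit Scope cat_scope with cat.
Local Open Scope cat_scope.

Local Obligation Tactic := idtac.

(* Categories are presented with a single type of arrows together with source
   and target maps, so that strict associativity and unitality of a tensor
   product of arrows are plain equations, without transport along equalities
   of objects.  Composition is a total function whose values on
   non-composable pairs are unconstrained and irrelevant. *)
Record category := Category {
  obj :> Type;
  mor : Type;
  dom : mor -> obj;
  cod : mor -> obj;
  idm : obj -> mor;
  comp : mor -> mor -> mor;
  dom_id : forall x, dom (idm x) = x;
  cod_id : forall x, cod (idm x) = x;
  dom_comp : forall g f, dom g = cod f -> dom (comp g f) = dom f;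
  cod_comp : forall g f, dom g = cod f -> cod (comp g f) = cod g;
  comp1m : forall f, comp (idm (cod f)) f = f;
  compm1 : forall f, comp f (idm (dom f)) = f;
  compA : forall h g f, dom h = cod g -> dom g = cod f ->
    comp h (comp g f) = comp (comp h g) f }.

Arguments idm {c} x.
Notation "g ∘ f" := (comp g f) (at level 48, left associativity) : cat_scope.

Definition hom (C : category) (x y : C) (f : mor C) : Prop :=
  dom f = x /\ cod f = y.

Definition mutually_inverse (C : category) (f g : mor C) : Prop :=
  [/\ hom (cod f) (dom f) g, g ∘ f = idm (dom f) & f ∘ g = idm (cod f)].

Definition is_iso (C : category) (f : mor C) : Prop :=
  exists g, mutually_inverse f g.

Definition isomorphic (C : category) (x y : C) : Prop :=
  exists f, hom x y f /\ is_iso f.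

Record functor (C D : category) := Functor {
  fobj :> C -> D;
  fmor : mor C -> mor D;
  dom_fmor : forall f, dom (fmor f) = fobj (dom f);
  cod_fmor : forall f, cod (fmor f) = fobj (cod f);
  fmor_id : forall x, fmor (idm x) = idm (fobj x);
  fmor_comp : forall g f, dom g = cod f -> fmor (g ∘ f) = fmor g ∘ fmor f }.

Record nat_iso (C D : category) (F G : functor C D) (eta : C -> mor D)
    : Prop := NatIso {
  nat_hom : forall x, hom (F x) (G x) (eta x);
  nat_inv : forall x, is_iso (eta x);
  nat_nat : forall f, eta (cod f) ∘ fmor F f = fmor G f ∘ eta (dom f) }.

Program Definition id_functor (C : category) : functor C C :=
  @Functor C C id id _ _ _ _.
Next Obligation. by []. Qed.
Next Obligation. by []. Qed.
Next Obligation. by []. Qed.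
Next Obligation. by []. Qed.

Program Definition comp_functor (C D E : category)
    (G : functor D E) (F : functor C D) : functor C E :=
  @Functor C E (G \o F) (fmor G \o fmor F) _ _ _ _.
Next Obligation. by move=> * /=; rewrite !dom_fmor. Qed.
Next Obligation. by move=> * /=; rewrite !cod_fmor. Qed.
Next Obligation. by move=> * /=; rewrite !fmor_id. Qed.
Next Obligation.
move=> C D E G F g f e /=.
by rewrite (fmor_comp F e) fmor_comp // dom_fmor cod_fmor e.
Qed.

Definition is_equivalence (C D : category) (F : functor C D) : Prop :=
  exists G : functor D C,
    (exists eta, nat_iso (id_functor C) (comp_functor G F) eta) /\
    (exists eps, nat_iso (comp_functor F G) (id_functor D) eps).

Record smcat := SMCat {
  smc_cat :> category;
  tens : smc_cat -> smc_cat -> smc_cat;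
  tensm : mor smc_cat -> mor smc_cat -> mor smc_cat;
  one : smc_cat;
  dom_tens : forall f g, dom (tensm f g) = tens (dom f) (dom g);
  cod_tens : forall f g, cod (tensm f g) = tens (cod f) (cod g);
  tensm_id : forall x y, tensm (idm x) (idm y) = idm (tens x y);
  tensm_comp : forall g f g' f', dom g = cod f -> dom g' = cod f' ->
    tensm (g ∘ f) (g' ∘ f') = tensm g g' ∘ tensm f f';
  tensA : forall x y z, tens x (tens y z) = tens (tens x y) z;
  tens1x : forall x, tens one x = x;
  tensx1 : forall x, tens x one = x;
  tensmA : forall f g h, tensm f (tensm g h) = tensm (tensm f g) h;
  tensm1f : forall f, tensm (idm one) f = f;
  tensmf1 : forall f, tensm f (idm one) = f }.

Arguments one {s}.
Notation "x ⊗ y" := (tens x y) (at level 38, left associativity) : cat_scope.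
Notation "f ⊠ g" := (tensm f g) (at level 38, left associativity) : cat_scope.
Notation "𝟙" := one : cat_scope.

Record rigid := Rigid {
  rigid_smc :> smcat;
  ldual : rigid_smc -> rigid_smc;
  evl : rigid_smc -> mor rigid_smc;
  coevl : rigid_smc -> mor rigid_smc;
  rdual : rigid_smc -> rigid_smc;
  evr : rigid_smc -> mor rigid_smc;
  coevr : rigid_smc -> mor rigid_smc;
  evl_hom : forall x, hom (ldual x ⊗ x) 𝟙 (evl x);
  coevl_hom : forall x, hom 𝟙 (x ⊗ ldual x) (coevl x);
  lsnake1 : forall x, (idm x ⊠ evl x) ∘ (coevl x ⊠ idm x) = idm x;
  lsnake2 : forall x,
    (evl x ⊠ idm (ldual x)) ∘ (idm (ldual x) ⊠ coevl x) = idm (ldual x);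
  evr_hom : forall x, hom (x ⊗ rdual x) 𝟙 (evr x);
  coevr_hom : forall x, hom 𝟙 (rdual x ⊗ x) (coevr x);
  rsnake1 : forall x, (evr x ⊠ idm x) ∘ (idm x ⊠ coevr x) = idm x;
  rsnake2 : forall x,
    (idm (rdual x) ⊠ evr x) ∘ (coevr x ⊠ idm (rdual x)) = idm (rdual x) }.

Definition ldualm (C : rigid) (f : mor C) : mor C :=
  let x := dom f in let y := cod f in
  (evl y ⊠ idm (ldual x)) ∘ (idm (ldual y) ⊠ f ⊠ idm (ldual x))
    ∘ (idm (ldual y) ⊠ coevl x).

Definition rdualm (C : rigid) (f : mor C) : mor C :=
  let x := dom f in let y := cod f in
  (idm (rdual x) ⊠ evr y) ∘ (idm (rdual x) ⊠ f ⊠ idm (rdual y))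
    ∘ (coevr x ⊠ idm (rdual y)).

Arguments ldualm : simpl never.
Arguments rdualm : simpl never.

(* The dualising functors reverse both composition and tensor products; their
   functoriality follows from the snake identities (see [ldualm_comp]). *)
Record srigid := SRigid {
  srigid_rigid :> rigid;
  ldual_tens : forall x y : srigid_rigid, ldual (x ⊗ y) = ldual y ⊗ ldual x;
  ldual_one : ldual 𝟙 = 𝟙 :> srigid_rigid;
  ldualm_tens : forall f g : mor srigid_rigid,
    ldualm (f ⊠ g) = ldualm g ⊠ ldualm f;
  rdual_tens : forall x y : srigid_rigid, rdual (x ⊗ y) = rdual y ⊗ rdual x;
  rdual_one : rdual 𝟙 = 𝟙 :> srigid_rigid;
  rdualm_tens : forall f g : mor srigid_rigid,
    rdualm (f ⊠ g) = rdualm g ⊠ rdualm f;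
  ldual_rdual : forall x : srigid_rigid, ldual (rdual x) = x;
  ldualm_rdualm : forall f : mor srigid_rigid, ldualm (rdualm f) = f;
  rdual_ldual : forall x : srigid_rigid, rdual (ldual x) = x;
  rdualm_ldualm : forall f : mor srigid_rigid, rdualm (ldualm f) = f }.

Definition invertible (C : rigid) (x : C) : Prop :=
  is_iso (evl x) /\ is_iso (coevl x).

Lemma dom_evl (C : rigid) (x : C) : dom (evl x) = ldual x ⊗ x.
Proof. by case: (evl_hom x). Qed.
Lemma cod_evl (C : rigid) (x : C) : cod (evl x) = 𝟙.
Proof. by case: (evl_hom x). Qed.
Lemma dom_coevl (C : rigid) (x : C) : dom (coevl x) = 𝟙.
Proof. by case: (coevl_hom x). Qed.
Lemma cod_coevl (C : rigid) (x : C) : cod (coevl x) = x ⊗ ldual x.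
Proof. by case: (coevl_hom x). Qed.

Hint Rewrite dom_id cod_id dom_fmor cod_fmor dom_tens cod_tens
  dom_evl cod_evl dom_coevl cod_coevl tensA tens1x tensx1 : dc.

(* Decides composability side conditions. *)
Ltac dc := rewrite ?/hom; intros; autorewrite with dc in *;
  repeat first [ rewrite dom_comp; last by dc | rewrite cod_comp; last by dc ];
  autorewrite with dc; try split; (done || congruence).

Lemma comp_id_l (C : category) (x : C) (f : mor C) :
  cod f = x -> idm x ∘ f = f.
Proof. by move=> <-; rewrite comp1m. Qed.
Lemma comp_id_r (C : category) (x : C) (f : mor C) :
  dom f = x -> f ∘ idm x = f.
Proof. by move=> <-; rewrite compm1. Qed.

Lemma interchange (C : smcat) (f g : mor C) (x y : C) :
  dom f = x -> cod g = y -> (f ⊠ idm y) ∘ (idm x ⊠ g) = f ⊠ g.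
Proof.
by move=> <- <-; rewrite -tensm_comp; [rewrite compm1 comp1m| dc..].
Qed.
Lemma interchange' (C : smcat) (f g : mor C) (x y : C) :
  cod f = x -> dom g = y -> (idm x ⊠ g) ∘ (f ⊠ idm y) = f ⊠ g.
Proof.
by move=> <- <-; rewrite -tensm_comp; [rewrite compm1 comp1m| dc..].
Qed.

Lemma whisker_l (C : smcat) (x : C) (g f : mor C) : dom g = cod f ->
  idm x ⊠ (g ∘ f) = (idm x ⊠ g) ∘ (idm x ⊠ f).
Proof. by move=> e; rewrite -tensm_comp ?comp_id_l; dc. Qed.
Lemma whisker_r (C : smcat) (x : C) (g f : mor C) : dom g = cod f ->
  (g ∘ f) ⊠ idm x = (g ⊠ idm x) ∘ (f ⊠ idm x).
Proof. by move=> e; rewrite -tensm_comp ?comp_id_l; dc. Qed.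

Lemma is_iso_id (C : category) (x : C) : is_iso (idm x).
Proof. by exists (idm x); split; rewrite ?comp_id_l; dc. Qed.

Lemma is_iso_comp (C : category) (g f : mor C) :
  dom g = cod f -> is_iso g -> is_iso f -> is_iso (g ∘ f).
Proof.
move=> e [g' [[dg cg] g1 g2]] [f' [[df cf] f1 f2]]; exists (f' ∘ g').
split; first by dc.
  rewrite compA; [|dc..]; rewrite -(@compA _ f') ?g1; [|dc..].
  by rewrite comp_id_r ?f1; dc.
rewrite compA; [|dc..]; rewrite -(@compA _ g) ?f2; [|dc..].
by rewrite -e compm1 g2; dc.
Qed.

Lemma is_iso_tens (C : smcat) (g f : mor C) :
  is_iso g -> is_iso f -> is_iso (g ⊠ f).
Proof.
move=> [g' [[dg cg] g1 g2]] [f' [[df cf] f1 f2]]; exists (g' ⊠ f').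
split; first by dc.
  by rewrite -tensm_comp; [rewrite g1 f1 tensm_id; dc|dc..].
by rewrite -tensm_comp; [rewrite g2 f2 tensm_id; dc|dc..].
Qed.

Section Dual.
Variable C : rigid.
Implicit Types f g h : mor C.

Lemma dom_ldualm f : dom (ldualm f) = ldual (cod f).
Proof. rewrite /ldualm; dc. Qed.
Lemma cod_ldualm f : cod (ldualm f) = ldual (dom f).
Proof. rewrite /ldualm; dc. Qed.
Hint Rewrite dom_ldualm cod_ldualm : dc.

Lemma evl_inj h h' x : cod h = ldual x -> cod h' = ldual x -> dom h = dom h' ->
  evl x ∘ (h ⊠ idm x) = evl x ∘ (h' ⊠ idm x) -> h = h'.
Proof.
suff E k : cod k = ldual x ->
    k = ((evl x ∘ (k ⊠ idm x)) ⊠ idm (ldual x)) ∘ (idm (dom k) ⊠ coevl x).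
  by move=> e e' d eq; rewrite (E h e) (E h' e') eq d.
move=> e; have -> : idm (ldual x) = idm (ldual x) ∘ idm (ldual x).
  by rewrite comp_id_l; dc.
rewrite tensm_comp; [|dc..]; rewrite -compA; [|dc..].
rewrite -tensmA tensm_id interchange; [|dc..].
rewrite -(@interchange' _ k _ (cod k) 𝟙); [|dc..].
by rewrite e tensmf1 compA; [rewrite lsnake2 comp_id_l|dc..].
Qed.

Lemma evl_ldualm f x y : hom x y f ->
  evl x ∘ (ldualm f ⊠ idm x) = evl y ∘ (idm (ldual y) ⊠ f).
Proof.
move=> [ex ey]; rewrite /ldualm ex ey.
rewrite !whisker_r; [|dc..].
rewrite -!tensmA !tensm_id.
rewrite -[evl x]tensm1f !compA; [|dc..].
rewrite (@interchange' _ (evl y) (evl x)); [|dc..].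
rewrite -(@interchange _ (evl y) (evl x) (ldual y ⊗ y) 𝟙); [|dc..].
rewrite tensmf1 -compA; [|dc..]; rewrite -compA; [|dc..]; congr (_ ∘ _).
rewrite -tensm_id compA; [|dc..].
rewrite -tensmA -tensm_comp; [|dc..].
rewrite interchange'; [|dc..].
rewrite comp_id_l; [|dc..].
rewrite -tensm_comp; [|dc..].
rewrite comp_id_l; [|dc..].
rewrite -(@interchange _ f (evl x) x 𝟙); [|dc..].
rewrite -compA; [|dc..].
by rewrite lsnake1 tensmf1 comp_id_r.
Qed.

Lemma ldualm_id x : ldualm (idm x) = idm (ldual x) :> mor C.
Proof.
by apply: (@evl_inj _ _ x); rewrite ?(@evl_ldualm _ x x); dc.
Qed.

Lemma ldualm_comp g f : dom g = cod f -> ldualm (g ∘ f) = ldualm f ∘ ldualm g.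
Proof.
move=> e; apply: (@evl_inj _ _ (dom f)); [dc..|].
rewrite (@evl_ldualm _ _ (cod g)); [|dc..].
rewrite (@whisker_r _ _ (ldualm f)) ?(@whisker_l _ _ g); [|dc..].
rewrite !compA; [|dc..].
rewrite (@evl_ldualm f (dom f) (cod f)) // -[RHS]compA; [|dc..].
rewrite interchange'; [|dc..].
rewrite -(@interchange _ (ldualm g) f (ldual (cod g)) (dom g)); [|dc..].
by rewrite compA -?e ?(@evl_ldualm g (dom g) (cod g)); dc.
Qed.
End Dual.
Hint Rewrite dom_ldualm cod_ldualm : dc.

Record smfunctor (C : smcat) := SMFunctor {
  smf_fun :> functor C C;
  smf_tens : forall x y, smf_fun (x ⊗ y) = smf_fun x ⊗ smf_fun y;
  smf_one : smf_fun 𝟙 = 𝟙;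
  smfm_tens : forall f g,
    fmor smf_fun (f ⊠ g) = fmor smf_fun f ⊠ fmor smf_fun g }.

Program Definition id_smfunctor (C : smcat) : smfunctor C :=
  @SMFunctor C (id_functor C) _ _ _.
Next Obligation. by []. Qed.
Next Obligation. by []. Qed.
Next Obligation. by []. Qed.

Program Definition lldual_functor (C : rigid) : functor C C :=
  @Functor C C (fun x => ldual (ldual x)) (fun f => ldualm (ldualm f)) _ _ _ _.
Next Obligation. by move=> C f /=; rewrite dom_ldualm cod_ldualm. Qed.
Next Obligation. by move=> C f /=; rewrite cod_ldualm dom_ldualm. Qed.
Next Obligation. by move=> C x /=; rewrite !ldualm_id. Qed.
Next Obligation.
by move=> C g f e /=; rewrite (ldualm_comp e) ldualm_comp // dom_ldualm cod_ldualm e.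
Qed.

Program Definition lldual (C : srigid) : smfunctor C :=
  @SMFunctor C (lldual_functor C) _ _ _.
Next Obligation. by move=> C x y /=; rewrite !ldual_tens. Qed.
Next Obligation. by move=> C /=; rewrite !ldual_one. Qed.
Next Obligation. by move=> C f g /=; rewrite !ldualm_tens. Qed.

(* The half-braidings of the Drinfeld centre are those for which [L] is the
   identity; the half-braidings of the anti-Drinfeld centre are those for which
   [L] is the double left dual. *)
Record half_braiding (C : smcat) (L : smfunctor C) (a : C) (s : C -> mor C)
    : Prop := HalfBraiding {
  hb_hom : forall y, hom (a ⊗ L y) (y ⊗ a) (s y);
  hb_inv : forall y, is_iso (s y);
  hb_nat : forall f, s (cod f) ∘ (idm a ⊠ fmor L f) = (f ⊠ idm a) ∘ s (dom f);
  hb_one : s 𝟙 = idm a;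
  hb_tens : forall y z,
    s (y ⊗ z) = (idm y ⊠ s z) ∘ (s y ⊠ idm (L z)) }.

Record tc_obj (C : smcat) (L : smfunctor C) := TCObj {
  tc_carrier :> C;
  tc_br : C -> mor C;
  tc_hb : half_braiding L tc_carrier tc_br }.

Record tc_mor (C : smcat) (L : smfunctor C) := TCMor {
  tc_src : tc_obj L;
  tc_tgt : tc_obj L;
  tc_val : mor C;
  tc_hom : hom (tc_src : C) (tc_tgt : C) tc_val;
  tc_comm : forall y, (idm y ⊠ tc_val) ∘ tc_br tc_src y
                      = tc_br tc_tgt y ∘ (tc_val ⊠ idm (L y)) }.

Section TwistedCentre.
Variables (C : smcat) (L : smfunctor C).
Implicit Types (A B : tc_obj L) (f g : tc_mor L).

Lemma tc_obj_eq A B : A = B :> C -> tc_br A = tc_br B -> A = B.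
Proof.
case: A B => [a s h] [b t k] /= e1 e2; subst b t.
by rewrite (Prop_irrelevance h k).
Qed.

Lemma tc_mor_eq f g : tc_src f = tc_src g -> tc_tgt f = tc_tgt g ->
  tc_val f = tc_val g -> f = g.
Proof.
case: f g => [a b u h k] [a' b' u' h' k'] /= e1 e2 e3; subst a' b' u'.
by rewrite (Prop_irrelevance h h') (Prop_irrelevance k k').
Qed.

Lemma dom_br A y : dom (tc_br A y) = A ⊗ L y.
Proof. by case: (hb_hom (tc_hb A) y). Qed.
Lemma cod_br A y : cod (tc_br A y) = y ⊗ A.
Proof. by case: (hb_hom (tc_hb A) y). Qed.
Lemma dom_val f : dom (tc_val f) = tc_src f.
Proof. by case: (tc_hom f). Qed.
Lemma cod_val f : cod (tc_val f) = tc_tgt f.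
Proof. by case: (tc_hom f). Qed.
Hint Rewrite dom_br cod_br dom_val cod_val : dc.

Program Definition tc_id A : tc_mor L := @TCMor C L A A (idm (A : C)) _ _.
Next Obligation. by move=> A; dc. Qed.
Next Obligation.
by move=> A y /=; rewrite !tensm_id comp_id_l ?comp_id_r; dc.
Qed.

Program Definition tc_comp_def g f (e : tc_src g = tc_tgt f) : tc_mor L :=
  @TCMor C L (tc_src f) (tc_tgt g) (tc_val g ∘ tc_val f) _ _.
Next Obligation. by move=> g f e /=; dc. Qed.
Next Obligation.
move=> g f e y /=.
rewrite whisker_l -?compA; [|dc..].
rewrite tc_comm -e compA; [|dc..]; rewrite tc_comm -compA; [|dc..].
by rewrite -whisker_r; dc.
Qed.

Definition tc_comp g f : tc_mor L :=
  if pselect (tc_src g = tc_tgt f) is left e then tc_comp_def e else f.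

Lemma tc_compE g f : tc_src g = tc_tgt f ->
  [/\ tc_src (tc_comp g f) = tc_src f, tc_tgt (tc_comp g f) = tc_tgt g
    & tc_val (tc_comp g f) = tc_val g ∘ tc_val f].
Proof. by rewrite /tc_comp; case: pselect. Qed.

Program Definition twisted_centre : category :=
  @Category (tc_obj L) (tc_mor L) (@tc_src C L) (@tc_tgt C L) tc_id tc_comp
    _ _ _ _ _ _ _.
Next Obligation. by []. Qed.
Next Obligation. by []. Qed.
Next Obligation. by move=> g f /tc_compE []. Qed.
Next Obligation. by move=> g f /tc_compE []. Qed.
Next Obligation.
move=> f; have [//|e1 e2 e3] := @tc_compE (tc_id (tc_tgt f)) f.
by apply: tc_mor_eq => //; rewrite e3 comp_id_l //=; dc.
Qed.
Next Obligation.
move=> f; have [//|e1 e2 e3] := @tc_compE f (tc_id (tc_src f)).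
by apply: tc_mor_eq => //; rewrite e3 comp_id_r //=; dc.
Qed.
Next Obligation.
move=> h g f e1 e2.
have [a1 b1 c1] := tc_compE e1; have [a2 b2 c2] := tc_compE e2.
have [|a3 b3 c3] := @tc_compE h (tc_comp g f); first by rewrite b2.
have [|a4 b4 c4] := @tc_compE (tc_comp h g) f; first by rewrite a1.
apply: tc_mor_eq; rewrite ?a3 ?a4 ?b3 ?b4 //.
by rewrite c3 c4 c1 c2 compA //; dc.
Qed.
End TwistedCentre.
Hint Rewrite dom_br cod_br dom_val cod_val : dc.

Lemma id_smfE (C : smcat) (y : C) : id_smfunctor C y = y.
Proof. by []. Qed.
Hint Rewrite id_smfE : dc.

Section Action.
Variables (C : smcat) (L : smfunctor C).
Implicit Types (X Y : tc_obj (id_smfunctor C)) (A B : tc_obj L).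

Definition act_br X A (y : C) : mor C :=
  (tc_br X y ⊠ idm (A : C)) ∘ (idm (X : C) ⊠ tc_br A y).

Lemma act_hb X A : half_braiding L (X ⊗ A) (act_br X A).
Proof.
have hX := tc_hb X; have hA := tc_hb A; rewrite /act_br; split=> [y|y|f||y z].
- dc.
- apply: is_iso_comp; [dc|apply: is_iso_tens..]; try exact: is_iso_id.
    exact: hb_inv hX y.
  exact: hb_inv hA y.
- rewrite -tensm_id -tensmA -compA; [|dc..].
  rewrite -whisker_l; [|dc..]; rewrite (hb_nat hA) whisker_l; [|dc..].
  rewrite compA; [|dc..]; rewrite tensmA -whisker_r; [|dc..].
  have /= -> := hb_nat hX f; rewrite whisker_r; [|dc..].
  by rewrite -tensmA tensm_id compA; dc.
- by rewrite (hb_one hX) (hb_one hA) !tensm_id comp_id_l; dc.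
- rewrite (hb_tens hX) (hb_tens hA) /= whisker_l ?whisker_r; [|dc..].
  rewrite !compA; [|dc..]; congr (_ ∘ _); last by rewrite tensmA.
  rewrite whisker_l; [|dc..]; rewrite -compA -?[RHS]compA; [|dc..].
  congr (_ ∘ _); first by rewrite tensmA.
  rewrite -[_ ⊠ idm z ⊠ _]tensmA -[_ ⊠ _ ⊠ idm (L z)]tensmA.
  rewrite ?[idm _ ⊠ (idm y ⊠ _)]tensmA [idm y ⊠ (_ ⊠ _)]tensmA !tensm_id.
  by rewrite interchange ?interchange'; dc.
Qed.

Definition tc_act X A : tc_obj L := TCObj (act_hb X A).

Program Definition tc_actm (f : tc_mor (id_smfunctor C)) (g : tc_mor L) :
    tc_mor L :=
  @TCMor C L (tc_act (tc_src f) (tc_src g)) (tc_act (tc_tgt f) (tc_tgt g))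
    (tc_val f ⊠ tc_val g) _ _.
Next Obligation. by move=> f g; dc. Qed.
Next Obligation.
move=> f g y /=; rewrite /act_br tensmA compA; [|dc..].
rewrite -tensm_comp; [|dc..].
have /= -> := tc_comm f y.
rewrite comp_id_r; [|dc..].
rewrite -[X in _ ⊠ X ∘ _](@comp_id_l _ (tc_tgt g)) ?tensm_comp; [|dc..].
rewrite -compA; [|dc..]; rewrite -[RHS]compA; [|dc..].
congr (_ ∘ _); rewrite -!tensmA -!tensm_comp; [|dc..].
by rewrite tc_comm comp_id_r ?comp_id_l; dc.
Qed.

Lemma tc_actm_id X A : tc_actm (tc_id X) (tc_id A) = tc_id (tc_act X A).
Proof. by apply: tc_mor_eq => //=; rewrite tensm_id. Qed.

Lemma tc_actm_comp f' f (g' g : tc_mor L) :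
  tc_src f' = tc_tgt f -> tc_src g' = tc_tgt g ->
  tc_actm (tc_comp f' f) (tc_comp g' g)
  = tc_comp (tc_actm f' g') (tc_actm f g).
Proof.
move=> e1 e2; have [a1 b1 c1] := tc_compE e1; have [a2 b2 c2] := tc_compE e2.
have [|a b c] := @tc_compE _ _ (tc_actm f' g') (tc_actm f g).
  by rewrite /= e1 e2.
apply: tc_mor_eq; rewrite ?a ?b ?c /= ?a1 ?a2 ?b1 ?b2 ?c1 ?c2 //.
by rewrite tensm_comp; dc.
Qed.

End Action.

Section Assoc.
Variables (C : smcat) (L : smfunctor C).

Lemma tc_actA (X Y : tc_obj (id_smfunctor C)) (A : tc_obj L) :
  tc_act X (tc_act Y A) = tc_act (tc_act X Y) A.
Proof.
apply: tc_obj_eq => /=; first exact: tensA.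
apply: functional_extensionality_dep => y /=.
rewrite /act_br /= /act_br whisker_l ?whisker_r; [|dc..].
by rewrite compA ?tensmA ?tensm_id -?tensmA ?tensm_id; dc.
Qed.

Lemma tc_actmA (f g : tc_mor (id_smfunctor C)) (h : tc_mor L) :
  tc_actm f (tc_actm g h) = tc_actm (tc_actm f g) h.
Proof. by apply: tc_mor_eq; rewrite /= ?tc_actA ?tensmA. Qed.
End Assoc.

Section Unit.
Variable C : smcat.
Implicit Types X : tc_obj (id_smfunctor C).

Lemma one_hb : half_braiding (id_smfunctor C) 𝟙 (fun y => idm y).
Proof.
split=> [y|y|f||y z] /=; [dc|exact: is_iso_id| |by []|].
  by rewrite tensm1f tensmf1 comp_id_l ?comp_id_r; dc.
by rewrite !tensm_id comp_id_l; dc.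
Qed.

Definition tc_one : tc_obj (id_smfunctor C) := TCObj one_hb.

Lemma tc_act1 (L : smfunctor C) (A : tc_obj L) : tc_act tc_one A = A.
Proof.
apply: tc_obj_eq => /=; first exact: tens1x.
apply: functional_extensionality_dep => y /=.
by rewrite /act_br /= tensm1f tensm_id comp_id_l; dc.
Qed.

Lemma tc_actm1 (L : smfunctor C) (f : tc_mor L) :
  tc_actm (tc_id tc_one) f = f.
Proof. by apply: tc_mor_eq; rewrite /= ?tc_act1 ?tensm1f. Qed.

Lemma tc_acto X : tc_act X tc_one = X.
Proof.
apply: tc_obj_eq => /=; first exact: tensx1.
apply: functional_extensionality_dep => y /=.
by rewrite /act_br /= tensmf1 tensm_id comp_id_r; dc.
Qed.

Lemma tc_actmo (f : tc_mor (id_smfunctor C)) : tc_actm f (tc_id tc_one) = f.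
Proof. by apply: tc_mor_eq; rewrite /= ?tc_acto ?tensmf1. Qed.
End Unit.

Definition centre (C : smcat) : smcat :=
  @SMCat (twisted_centre (id_smfunctor C)) (@tc_act C _) (@tc_actm C _)
    (tc_one C) (fun _ _ => erefl) (fun _ _ => erefl) (@tc_actm_id C _)
    (fun g f g' f' => @tc_actm_comp C _ g f g' f') (@tc_actA C _)
    (@tc_act1 C _) (@tc_acto C) (@tc_actmA C _) (@tc_actm1 C _) (@tc_actmo C).

(* Left module categories whose action is strictly associative and unital. *)
Record lmodcat (M : smcat) := LModCat {
  lm_cat :> category;
  act : M -> lm_cat -> lm_cat;
  actm : mor M -> mor lm_cat -> mor lm_cat;
  dom_act : forall f g, dom (actm f g) = act (dom f) (dom g);
  cod_act : forall f g, cod (actm f g) = act (cod f) (cod g);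
  actm_id : forall x a, actm (idm x) (idm a) = idm (act x a);
  actm_comp : forall g f g' f', dom g = cod f -> dom g' = cod f' ->
    actm (g ∘ f) (g' ∘ f') = actm g g' ∘ actm f f';
  actA : forall x y a, act x (act y a) = act (x ⊗ y) a;
  act1x : forall a, act 𝟙 a = a;
  actmA : forall f g h, actm f (actm g h) = actm (f ⊠ g) h;
  actm1f : forall f, actm (idm 𝟙) f = f }.

Definition regular_module (M : smcat) : lmodcat M :=
  @LModCat M M (@tens M) (@tensm M) (@dom_tens M) (@cod_tens M) (@tensm_id M)
    (@tensm_comp M) (@tensA M) (@tens1x M) (@tensmA M) (@tensm1f M).

Definition anti_centre (C : srigid) : lmodcat (centre C) :=
  @LModCat (centre C) (twisted_centre (lldual C)) (@tc_act C _) (@tc_actm C _)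
    (fun _ _ => erefl) (fun _ _ => erefl) (@tc_actm_id C _)
    (fun g f g' f' => @tc_actm_comp C _ g f g' f') (@tc_actA C _)
    (@tc_act1 C _) (@tc_actmA C _) (@tc_actm1 C _).

Record modfunctor (M : smcat) (A B : lmodcat M) := ModFunctor {
  mf_fun :> functor A B;
  mf_str : M -> A -> mor B;
  mf_hom : forall x a,
    hom (mf_fun (act x a)) (act x (mf_fun a)) (mf_str x a);
  mf_inv : forall x a, is_iso (mf_str x a);
  mf_nat : forall (f : mor M) (g : mor A),
    mf_str (cod f) (cod g) ∘ fmor mf_fun (actm f g)
    = actm f (fmor mf_fun g) ∘ mf_str (dom f) (dom g);
  mf_tens : forall x y a,
    mf_str (x ⊗ y) a = actm (idm x) (mf_str y a) ∘ mf_str x (act y a);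
  mf_one : forall a, mf_str 𝟙 a = idm (mf_fun a) }.

Definition modequiv (M : smcat) (A B : lmodcat M) :=
  {F : modfunctor A B | is_equivalence F}.

Definition modequiv_iso (M : smcat) (A B : lmodcat M)
    (F G : modequiv A B) : Prop :=
  exists eta : A -> mor B, nat_iso (sval F) (sval G) eta /\
    forall (x : M) (a : A), mf_str (sval G) x a ∘ eta (act x a)
      = actm (idm x) (eta a) ∘ mf_str (sval F) x a.

(* The functor [x |-> β ⊗ ∨∨x ⊗ ∨β] is monoidal with structure maps
   [β ⊗ ∨∨x ⊗ ev_β ⊗ ∨∨y ⊗ ∨β] and [coev_β]; the last two fields say that [rho]
   is a monoidal transformation from the identity to it. *)
Record quasi_pivotal (C : srigid) := QuasiPivotal {
  qp_obj : C;
  qp_rho : C -> mor C;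
  qp_invertible : invertible qp_obj;
  qp_hom : forall x,
    hom x (qp_obj ⊗ lldual C x ⊗ ldual qp_obj) (qp_rho x);
  qp_inv : forall x, is_iso (qp_rho x);
  qp_nat : forall f : mor C, qp_rho (cod f) ∘ f
    = (idm qp_obj ⊠ fmor (lldual C) f ⊠ idm (ldual qp_obj)) ∘ qp_rho (dom f);
  qp_tens : forall x y, qp_rho (x ⊗ y)
    = (idm (qp_obj ⊗ lldual C x) ⊠ evl qp_obj
        ⊠ idm (lldual C y ⊗ ldual qp_obj)) ∘ (qp_rho x ⊠ qp_rho y);
  qp_one : qp_rho 𝟙 = coevl qp_obj }.

Definition qp_equiv (C : srigid) (P Q : quasi_pivotal C) : Prop :=
  exists phi psi : mor C,
    [/\ hom (qp_obj Q) (qp_obj P) phi, mutually_inverse phi psi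
      & forall x, qp_rho Q x
          = (psi ⊠ idm (lldual C x) ⊠ ldualm phi) ∘ qp_rho P x].

(* The objects of the anti-Drinfeld centre whose isomorphism classes make up
   its Picard heap. *)
Definition pic_obj (C : srigid) :=
  {A : anti_centre C | invertible (tc_carrier A)}.

Definition pic_iso (C : srigid) (A B : pic_obj C) : Prop :=
  isomorphic (sval A) (sval B).

Definition classes (T : Type) (R : T -> T -> Prop) : Type :=
  {K : set T | exists x, K = [set y | R x y]%classic}.

Lemma mutually_inverse_sym (C : category) (f g : mor C) :
  mutually_inverse f g -> mutually_inverse g f.
Proof. by move=> [[e1 e2] e3 e4]; split; rewrite /hom ?e1 ?e2. Qed.

Lemma isomorphic_equivalence (C : category) : Equivalence (@isomorphic C).
Proof.
split=> [x|x y|x y z].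
- by exists (idm x); split; [dc|exact: is_iso_id].
- move=> [f [[e1 e2] [g fg]]]; have [[d1 d2] _ _] := fg.
  by exists g; split; [dc|exists f; exact: mutually_inverse_sym].
- move=> [f [[e1 e2] fi]] [g [[d1 d2] gi]].
  by exists (g ∘ f); split; [dc|apply: is_iso_comp; dc].
Qed.

Lemma pic_iso_equivalence (C : srigid) : Equivalence (@pic_iso C).
Proof.
have [r s t] := isomorphic_equivalence (anti_centre C).
by split=> [A|A B|A B D]; [exact: r|exact: s|exact: t].
Qed.

Lemma qp_equiv_equivalence (C : srigid) : Equivalence (@qp_equiv C).
Proof.
have rhoE (P : quasi_pivotal C) x : (dom (qp_rho P x) = x) *
    (cod (qp_rho P x) = qp_obj P ⊗ lldual C x ⊗ ldual (qp_obj P)).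
  by case: (qp_hom P x).
split=> [P|P Q|P Q R].
- exists (idm (qp_obj P)), (idm (qp_obj P)); split; first by dc.
    by split; rewrite ?comp_id_l; dc.
  by move=> x; rewrite ldualm_id !tensm_id comp_id_l ?rhoE.
- move=> [f [g [[e1 e2] fg E]]]; have [[d1 d2] c1 c2] := fg.
  exists g, f; split; [by dc|exact: mutually_inverse_sym|move=> x].
  rewrite E compA; [|autorewrite with dc; rewrite ?rhoE; dc..].
  rewrite -!tensm_comp; [|dc..].
  rewrite -ldualm_comp; [|dc..].
  by rewrite c2 e2 comp_id_l ?ldualm_id ?tensm_id ?comp_id_l ?rhoE; dc.
- move=> [f [g [[e1 e2] fg E]]] [f' [g' [[e1' e2'] fg' E']]].
  have [[d1 d2] c1 c2] := fg; have [[d1' d2'] c1' c2'] := fg'.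
  exists (f ∘ f'), (g' ∘ g); split; first by dc.
    split; first by dc.
      rewrite compA; [|dc..]; rewrite -(@compA _ g'); [|dc..].
      by rewrite c1 comp_id_r ?c1' ?dom_comp; dc.
    rewrite compA; [|dc..]; rewrite -(@compA _ f); [|dc..].
    by rewrite c2' comp_id_r ?c2 ?cod_comp; dc.
  move=> x; rewrite E' E compA; [|autorewrite with dc; rewrite ?rhoE; dc..].
  rewrite -!tensm_comp; [|dc..].
  by rewrite -ldualm_comp ?comp_id_l; dc.
Qed.

Lemma nat_iso_sym (C D : category) (F G : functor C D) eta theta :
  nat_iso F G eta -> (forall x, mutually_inverse (eta x) (theta x)) ->
  nat_iso G F theta.
Proof.
move=> [h _ n] inv.
have e x : dom (eta x) = F x by case: (h x).
have e' x : cod (eta x) = G x by case: (h x).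
have d x : dom (theta x) = G x by case: (inv x) => -[]; rewrite e'.
have d' x : cod (theta x) = F x by case: (inv x) => -[_]; rewrite e.
split=> [x|x|f]; first by split.
  by exists (eta x); exact: mutually_inverse_sym.
have [_ a _] := inv (cod f); have [_ _ b] := inv (dom f).
have hint := (@e, @e', @d, @d').
rewrite -[fmor G f](@comp_id_r _ (G (dom f))) -?e' -?b; [|dc..].
rewrite (@compA _ (fmor G f)); [|by rewrite ?hint; dc..].
rewrite -n -(@compA _ (eta (cod f))); [|by rewrite ?hint; dc..].
rewrite compA ?a ?comp_id_l //;
  by rewrite ?hint ?dom_comp ?cod_comp ?hint ?dom_fmor ?cod_fmor ?hint.
Qed.

Lemma modequiv_iso_equivalence (M : smcat) (A B : lmodcat M) :
  Equivalence (@modequiv_iso M A B).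
Proof.
have sE (F : modfunctor A B) x a : (dom (mf_str F x a) = F (act x a)) *
  (cod (mf_str F x a) = act x (F a)) by case: (mf_hom F x a).
split=> [F|F G|F G H].
- exists (fun a => idm (sval F a)); split.
    split=> [a|a|f]; [dc|exact: is_iso_id|].
    by rewrite comp_id_l ?comp_id_r; dc.
  by move=> x a; rewrite actm_id comp_id_l ?comp_id_r ?sE.
- move=> [eta [en em]]; have [h iv n] := en.
  have [theta inv] := choice iv; exists theta.
  split; first exact: nat_iso_sym en inv.
  move=> x a.
  have e y : (dom (eta y) = sval F y) * (cod (eta y) = sval G y) by case: (h y).
  have d y : (dom (theta y) = sval G y) * (cod (theta y) = sval F y).
    by case: (inv y) => -[]; rewrite !e.
  have [_ p _] := inv a; have [_ _ q] := inv (act x a).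
  have {p} P : actm (idm x) (theta a) ∘ actm (idm x) (eta a)
      = idm (act x (sval F a)).
    by rewrite -actm_comp ?p ?comp_id_l ?e ?d ?actm_id ?dom_id ?cod_id.
  have {}q : eta (act x a) ∘ theta (act x a) = idm (sval G (act x a)).
    by rewrite q e.
  have hint := (dom_act, cod_act, dom_id, cod_id, @sE, @e, @d).
  have E := em x a.
  rewrite -(@comp_id_l _ _ (mf_str (sval F) x a ∘ theta (act x a)) erefl).
  rewrite cod_comp ?hint // -P -compA; last by rewrite ?cod_comp ?hint.
    rewrite (@compA _ (actm _ (eta a))) ?hint // -E -compA ?hint //.
    by rewrite q comp_id_r ?hint.
  by rewrite ?hint.
- move=> [eta [en em]] [theta [tn tm]]; have [h iv n] := en.
  have [h' iv' n'] := tn.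
  have e y : (dom (eta y) = sval F y) * (cod (eta y) = sval G y) by case: (h y).
  have d y : (dom (theta y) = sval G y) * (cod (theta y) = sval H y).
    by case: (h' y).
  have hint := (dom_act, cod_act, dom_id, cod_id, dom_fmor, cod_fmor,
    @sE, @e, @d).
  exists (fun a => theta a ∘ eta a); split.
    split=> [a|a|f].
    + by split; rewrite ?dom_comp ?cod_comp ?hint.
    + by apply: is_iso_comp; rewrite ?hint.
    + rewrite -compA ?hint // n compA ?hint // n' -compA ?hint //.
  move=> x a; rewrite compA ?hint // tm -compA ?hint // em compA ?hint //.
  by rewrite -actm_comp ?comp_id_l ?hint.
Qed.

(* Main.v *)
From mathcomp Require Import all_boot boolp classical_sets.
Require Import Defs.

(** Write [L] for the double left dual.  A quasi-pivotal structure on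
    [β] and a half-braiding making [β] an object of the anti-Drinfeld centre
    are the same data up to bending one leg.  If [β] has a left dual, arrows
    [x -> β ⊗ L x ⊗ ∨β] correspond by the snake identities to arrows
    [x ⊗ β -> β ⊗ L x]; under this bijection naturality and monoidality of
    [ρ_β] become naturality and the hexagon for the inverse of a half-braiding
    [β ⊗ L x -> x ⊗ β] ([bent_nat], [bent_one], [bent_tens]).  For invertible
    [β], one family consists of isomorphisms exactly when the other does
    ([bent_iso]), and bending turns the equivalence of quasi-pivotal structures
    into isomorphism in the anti-Drinfeld centre ([qp_equiv_pic]).  This is the
    bijection between (i) and (ii).

    For (ii) and (iii), a module functor [F] out of the regular module is
    determined by [F 𝟙]: its structure maps give [F X ≅ X ⊗ F 𝟙]
    ([modfunctor_orbit]).  So everything reduces to showing that, for [α] in the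
    anti-Drinfeld centre, [- ⊗ α] is an equivalence if and only if the
    underlying object of [α] is invertible.

    The dual [∨α] carries a half-braiding of the opposite kind
    [∨α ⊗ y -> L y ⊗ ∨α], so that [B ⊗ ∨α] lies in the Drinfeld centre for every
    [B] in the anti-Drinfeld centre.  The only delicate point is that this
    half-braiding is invertible; it is so because over a rigid category every
    natural monoidal family of this shape is ([lax_braiding_iso]).  The
    coevaluation [𝟙 -> α ⊗ ∨α] and [B ⊗ ev : B ⊗ ∨α ⊗ α -> B] are then arrows of
    the two centres ([tc_coev], [tc_ev]).

    If [α] is invertible, they give the unit and the counit exhibiting [- ⊗ ∨α]
    as quasi-inverse to [- ⊗ α] ([invertible_equivalence]).  Conversely, suppose
    that [- ⊗ α] is full and faithful.  By fullness, [α ⊗ ev] is [f ⊗ α] for some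
    [f : α ⊗ ∨α -> 𝟙], and the snake identities together with faithfulness
    make [f] inverse to the coevaluation.  An isomorphism [α ⊗ ∨α ≅ 𝟙] alone does
    not make [α] invertible, but the half-braiding of [α] at the right dual
    [α^∨] is an isomorphism
    [α ⊗ ∨α = α ⊗ L (α^∨) ≅ α^∨ ⊗ α], so [α^∨] is a left inverse of [α] and
    the evaluation is invertible as well ([full_faithful_invertible]). *)

Set Implicit Arguments.
Unset Strict Implicit.
Unset Printing Implicit Defensive.

Local Open Scope cat_scope.
Local Obligation Tactic := idtac.

(** * Composability side conditions and inverses *)

Hint Rewrite smf_tens smf_one : dc.

(** In contrast with [dc], the sources and targets recorded in the context are
    substituted before the objects are compared, since the comparison may need
    associativity of the tensor product after the substitution. *)
Ltac ty_step := match goal with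
  | H : dom ?f = _ |- context [dom ?f] => rewrite H
  | H : cod ?f = _ |- context [cod ?f] => rewrite H
  | H : forall y, hom _ _ (?s y) |- context [dom (?s ?z)] => rewrite (proj1 (H z))
  | H : forall y, hom _ _ (?s y) |- context [cod (?s ?z)] => rewrite (proj2 (H z))
  end.
Ltac ty :=
  intros; rewrite ?/hom; try split; autorewrite with dc;
  repeat first
    [ ty_step; autorewrite with dc
    | rewrite dom_comp; [autorewrite with dc | solve [ty]]
    | rewrite cod_comp; [autorewrite with dc | solve [ty]] ];
  solve [reflexivity | congruence].

Section Inverses.
Variable D : category.

Lemma mutually_inverse_id (x : D) :
  mutually_inverse (idm x) (idm x).
Proof. by split; rewrite ?comp_id_l; ty. Qed.

Lemma mutually_inverse_comp (g g' f f' : mor D) :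
  mutually_inverse g g' -> mutually_inverse f f' -> dom g = cod f ->
  mutually_inverse (g ∘ f) (f' ∘ g').
Proof.
move=> [[dg cg] g1 g2] [[df cf] f1 f2] e; split; first by ty.
  rewrite compA; [|ty..]; rewrite -(@compA _ f'); [|ty..].
  by rewrite g1 comp_id_r ?f1; ty.
rewrite compA; [|ty..]; rewrite -(@compA _ g); [|ty..].
by rewrite f2 comp_id_r ?g2; ty.
Qed.

Lemma mutually_inverse_uniq (f g h : mor D) :
  mutually_inverse f g -> mutually_inverse f h -> g = h.
Proof.
move=> [[dg cg] g1 g2] [[dh ch] h1 h2].
rewrite -(@comp_id_l _ (dom f) g) // -h1 -compA; [|ty..].
by rewrite g2 comp_id_r.
Qed.

Lemma square_inv (s s' t t' f g : mor D) :
  mutually_inverse s s' -> mutually_inverse t t' ->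
  dom f = dom s -> cod f = dom t -> dom g = cod s -> cod g = cod t ->
  t ∘ f = g ∘ s -> t' ∘ g = f ∘ s'.
Proof.
move=> [[ds cs] s1 s2] [[dt ct] t1 t2] df cf dg cg e.
rewrite -(@comp_id_r _ (cod s) g) // -s2 (@compA _ g); [|ty..].
rewrite -e compA; [|ty..]; rewrite compA; [|ty..].
by rewrite t1 comp_id_l; ty.
Qed.

Lemma iso_monic (f f' g h : mor D) : mutually_inverse f f' ->
  dom f = cod g -> dom f = cod h -> f ∘ g = f ∘ h -> g = h.
Proof.
move=> [[d c] e _] dg dh eq.
rewrite -(@comp_id_l _ _ g (esym dg)) -(@comp_id_l _ _ h (esym dh)) -e.
by rewrite -!compA ?eq; ty.
Qed.

Lemma iso_epic (f f' g h : mor D) : mutually_inverse f f' ->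
  dom g = cod f -> dom h = cod f -> g ∘ f = h ∘ f -> g = h.
Proof.
move=> [[d c] _ e] dg dh eq.
rewrite -(@comp_id_r _ _ g dg) -(@comp_id_r _ _ h dh) -e.
by rewrite !compA ?eq; ty.
Qed.

(** Chosen by excluded middle and choice, so that inverses of a family of
    isomorphisms form a family again. *)
Definition inv_mor (f : mor D) : mor D :=
  if pselect (is_iso f) is left i then projT1 (cid i) else f.

Lemma inv_morP (f : mor D) :
  is_iso f -> mutually_inverse f (inv_mor f).
Proof. by rewrite /inv_mor; case: pselect => // i _; case: cid. Qed.

End Inverses.

Lemma mutually_inverse_tens (C : smcat) (g g' f f' : mor C) :
  mutually_inverse g g' -> mutually_inverse f f' ->
  mutually_inverse (g ⊠ f) (g' ⊠ f').
Proof.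
move=> [[dg cg] g1 g2] [[df cf] f1 f2]; split; first by ty.
  by rewrite -tensm_comp; [rewrite g1 f1 tensm_id; ty|ty..].
by rewrite -tensm_comp; [rewrite g2 f2 tensm_id; ty|ty..].
Qed.

(** * Bending a leg along a left dual *)

Section Bend.
Variable C : rigid.
Implicit Types (a X Y : C) (f g h : mor C).

Definition bend a X h := (idm X ⊠ evl a) ∘ (h ⊠ idm a).
Definition unbend a Y g := (g ⊠ idm (ldual a)) ∘ (idm Y ⊠ coevl a).

Lemma bend_hom a X Y h : hom Y (X ⊗ ldual a) h -> hom (Y ⊗ a) X (bend a X h).
Proof. by rewrite /bend => -[d c]; ty. Qed.

Lemma unbend_hom a X Y g : hom (Y ⊗ a) X g -> hom Y (X ⊗ ldual a) (unbend a Y g).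
Proof. by rewrite /unbend => -[d c]; ty. Qed.

Lemma unbendK a X Y g : hom (Y ⊗ a) X g -> bend a X (unbend a Y g) = g.
Proof.
move=> [d c]; rewrite /bend /unbend whisker_r; [|ty..].
rewrite compA; [|ty..].
rewrite -!tensmA tensm_id interchange'; [|ty..].
rewrite -(@interchange _ g (evl a) (Y ⊗ a) 𝟙); [|ty..].
rewrite tensmf1 -compA; [|ty..].
rewrite -tensm_id -tensmA -whisker_l; [|ty..].
by rewrite lsnake1 tensm_id comp_id_r.
Qed.

Lemma bendK a X Y h : hom Y (X ⊗ ldual a) h -> unbend a Y (bend a X h) = h.
Proof.
move=> [d c]; rewrite /bend /unbend whisker_r; [|ty..].
rewrite -compA; [|ty..].
rewrite -[_ ⊠ idm a ⊠ _]tensmA tensm_id interchange; [|ty..].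
rewrite -(@interchange' _ h (coevl a) (X ⊗ ldual a) 𝟙); [|ty..].
rewrite tensmf1 compA; [|ty..].
rewrite -tensm_id -!tensmA -whisker_l; [|ty..].
by rewrite lsnake2 tensm_id comp_id_l.
Qed.

(** Bending is how equations between arrows into [X ⊗ ∨a] are proved below:
    the bent arrows contain fewer zigzags. *)
Lemma bend_inj a X Y h h' : hom Y (X ⊗ ldual a) h -> hom Y (X ⊗ ldual a) h' ->
  bend a X h = bend a X h' -> h = h'.
Proof. by move=> H H' e; rewrite -(bendK H) e bendK. Qed.

Lemma bend_pre a X h k : cod h = X ⊗ ldual a -> dom h = cod k ->
  bend a X (h ∘ k) = bend a X h ∘ (k ⊠ idm a).
Proof. by move=> c e; rewrite /bend whisker_r ?compA; ty. Qed.

Lemma bend_post a X X' f h : hom X X' f -> cod h = X ⊗ ldual a ->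
  bend a X' ((f ⊠ idm (ldual a)) ∘ h) = f ∘ bend a X h.
Proof.
move=> [d c] e; rewrite /bend whisker_r ?compA; [|ty..].
congr (_ ∘ _); rewrite -tensmA tensm_id interchange'; [|ty..].
by rewrite -(@interchange _ f _ X 𝟙) ?tensmf1; ty.
Qed.

Lemma bend_whisker a X W h : cod h = X ⊗ ldual a ->
  bend a (W ⊗ X) (idm W ⊠ h) = idm W ⊠ bend a X h.
Proof.
by move=> c; rewrite /bend whisker_l -?tensm_id -?tensmA; ty.
Qed.

(** The transpose [∨f] slides around the evaluation and becomes [f]. *)
Lemma bend_ldualm a b X f h : hom a b f -> cod h = X ⊗ ldual b ->
  bend a X ((idm X ⊠ ldualm f) ∘ h) = bend b X h ∘ (idm (dom h) ⊠ f).
Proof.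
move=> [d c] ch; rewrite /bend whisker_r ?compA; [|ty..].
rewrite -tensmA -whisker_l; [|ty..].
rewrite (evl_ldualm (conj d c)) whisker_l; [|ty..].
rewrite -compA; [|ty..]; rewrite -compA; [|ty..]; congr (_ ∘ _).
by rewrite tensmA tensm_id interchange' ?interchange; ty.
Qed.

End Bend.

(** * Half-braidings and their inverses *)

Section Braidings.
Variable C : smcat.
Implicit Types (K L M : smfunctor C) (a b : C).

(** Two twists are needed because the half-braiding on [a] is twisted by [L] at
    the source, the one on [∨a] at the target, and the one on [b ⊗ ∨a] not at
    all.  Invertibility is not demanded: over a rigid category it is
    automatic. *)
Record lax_braiding K L a (s : C -> mor C) : Prop := LaxBraiding {
  lb_hom : forall y, hom (a ⊗ L y) (K y ⊗ a) (s y);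
  lb_nat : forall f, s (cod f) ∘ (idm a ⊠ fmor L f)
    = (fmor K f ⊠ idm a) ∘ s (dom f);
  lb_one : s 𝟙 = idm a;
  lb_tens : forall y z,
    s (y ⊗ z) = (idm (K y) ⊠ s z) ∘ (s y ⊠ idm (L z)) }.

Lemma half_braidingP L a s : half_braiding L a s <->
  lax_braiding (id_smfunctor C) L a s /\ forall y, is_iso (s y).
Proof. by split=> [[h i n o t]|[[h n o t] i]]. Qed.

(** Twists compose: the tensor product cancels the twist [L] in the middle. *)
Lemma lax_braiding_tens K L M a b s t :
  lax_braiding K L a s -> lax_braiding L M b t ->
  lax_braiding K M (a ⊗ b) (fun y => (s y ⊠ idm b) ∘ (idm a ⊠ t y)).
Proof.
move=> [hs ns os ts] [ht nt ot tt]; split=> [y|f||y z].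
- ty.
- rewrite -tensm_id -tensmA -compA; [|ty..].
  rewrite -whisker_l ?nt ?whisker_l; [|ty..].
  rewrite compA; [|ty..]; rewrite tensmA -whisker_r ?ns ?whisker_r; [|ty..].
  by rewrite -tensmA tensm_id compA; ty.
- by rewrite os ot !tensm_id comp_id_l; ty.
- rewrite ts tt whisker_l ?whisker_r; [|ty..].
  rewrite !compA; [|ty..]; congr (_ ∘ _); last by rewrite tensmA.
  rewrite whisker_l; [|ty..]; rewrite -compA -?[RHS]compA; [|ty..].
  congr (_ ∘ _); first by rewrite tensmA.
  rewrite -[_ ⊠ idm (L z) ⊠ _]tensmA -[_ ⊠ _ ⊠ idm (M z)]tensmA.
  rewrite ?[idm _ ⊠ (idm _ ⊠ _)]tensmA ?[idm _ ⊠ (_ ⊠ _)]tensmA !tensm_id.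
  by rewrite interchange ?interchange'; ty.
Qed.

(** The axioms of [half_braiding] transported to the inverse arrows; quasi-pivotal
    structures produce these directly. *)
Record oplax_braiding L a (t : C -> mor C) : Prop := OplaxBraiding {
  ob_hom : forall y, hom (y ⊗ a) (a ⊗ L y) (t y);
  ob_nat : forall f, t (cod f) ∘ (f ⊠ idm a) = (idm a ⊠ fmor L f) ∘ t (dom f);
  ob_one : t 𝟙 = idm a;
  ob_tens : forall y z, t (y ⊗ z) = (t y ⊠ idm (L z)) ∘ (idm y ⊠ t z) }.

Lemma half_braiding_inv L a s t : (forall y, mutually_inverse (s y) (t y)) ->
  half_braiding L a s <-> oplax_braiding L a t.
Proof.
move=> st; have ts y := mutually_inverse_sym (st y).
split=> -[h].
- move=> inv n o te; have ht y : hom (y ⊗ a) (a ⊗ L y) (t y).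
    by have [[d c] _ _] := st y; ty.
  split=> // [f||y z].
  + have /= nf := n f; by apply: (square_inv (st _) (st _)); ty.
  + by apply: mutually_inverse_uniq (st 𝟙) _; rewrite o; apply: mutually_inverse_id.
  + apply: mutually_inverse_uniq (st (y ⊗ z)) _; rewrite te.
    apply: mutually_inverse_comp; last by ty.
      by apply: mutually_inverse_tens => //; apply: mutually_inverse_id.
    by apply: mutually_inverse_tens => //; apply: mutually_inverse_id.
- move=> n o te; have hs y : hom (a ⊗ L y) (y ⊗ a) (s y).
    by have [[d c] _ _] := ts y; ty.
  split=> // [y|f||y z].
  + by exists (t y).
  + have /= nf := n f; by apply: (square_inv (ts _) (ts _)); ty.
  + by apply: mutually_inverse_uniq (ts 𝟙) _; rewrite o; apply: mutually_inverse_id.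
  + apply: mutually_inverse_uniq (ts (y ⊗ z)) _; rewrite te.
    apply: mutually_inverse_comp; last by ty.
      by apply: mutually_inverse_tens => //; apply: mutually_inverse_id.
    by apply: mutually_inverse_tens => //; apply: mutually_inverse_id.
Qed.

End Braidings.

Section LaxInv.
Variables (C : rigid) (K L : smfunctor C) (a : C) (s : C -> mor C).
Hypothesis hs : lax_braiding K L a s.

(** The inverse at [y] is the braiding at the right dual of [y] with both of its
    strings bent around: naturality with respect to the evaluation and the
    coevaluation of [y], together with the value at a tensor product, reduces
    both composites to a snake identity transported by [L] or by [K]. *)
Lemma lax_braiding_iso y : is_iso (s y).
Proof.
have [h n o t] := hs; have [devr cevr] := evr_hom y; have [dcoe ccoe] := coevr_hom y.
pose r := rdual y.
(* [Ky ⊗ a -> Ky ⊗ a ⊗ Lr ⊗ Ly -> Ky ⊗ Kr ⊗ a ⊗ Ly -> a ⊗ Ly] *)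
pose u := (fmor K (evr y) ⊠ idm (a ⊗ L y)) ∘ (idm (K y) ⊠ s r ⊠ idm (L y))
  ∘ (idm (K y ⊗ a) ⊠ fmor L (coevr y)).
have du : dom u = K y ⊗ a by rewrite /u; ty.
have cu : cod u = a ⊗ L y by rewrite /u; ty.
have snake (M : smfunctor C) :
    (fmor M (evr y) ⊠ idm (M y)) ∘ (idm (M y) ⊠ fmor M (coevr y)) = idm (M y).
  by rewrite -!fmor_id -!smfm_tens -fmor_comp ?rsnake1; ty.
exists u; split; first by ty.
- rewrite (proj1 (h y)) /u -compA; [|ty..].
  rewrite -[s y in X in _ ∘ X]tensmf1 interchange'; [|ty..].
  rewrite -(@interchange _ (s y) _ (a ⊗ L y) (L r ⊗ L y)); [|ty..].
  rewrite compA; [|ty..]; rewrite -(@compA _ (_ ⊠ idm (a ⊗ L y))); [|ty..].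
  rewrite -[idm (L r ⊗ L y)]tensm_id -[idm (a ⊗ L y)]tensm_id !tensmA.
  rewrite -whisker_r -?t; [|ty..].
  have := n (evr y); rewrite devr cevr o -/r => nr.
  rewrite -whisker_r -?nr; [|ty..].
  rewrite comp_id_l; [|ty..].
  rewrite tensm_id -tensm_id -!tensmA -whisker_l; [|ty..].
  by rewrite snake.
- rewrite (proj2 (h y)) /u -(@compA _ (_ ⊠ idm (a ⊗ L y))) ?compA; [|ty..].
  rewrite -[s y in X in X ∘ _ ∘ _]tensm1f interchange'; [|ty..].
  rewrite -(@interchange _ _ (s y) (K y ⊗ K r) (K y ⊗ a)); [|ty..].
  rewrite -(@compA _ _ (idm (K y ⊗ K r) ⊠ s y)); [|ty..].
  rewrite -[idm (K y ⊗ K r)]tensm_id -[idm (K y ⊗ a)]tensm_id -!tensmA.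
  rewrite -whisker_l -?t; [|ty..].
  have := n (coevr y); rewrite dcoe ccoe o -/r => nr.
  rewrite -compA; [|ty..]; rewrite -whisker_l ?nr; [|ty..].
  rewrite comp_id_r; [|ty..].
  rewrite tensm_id -tensm_id !tensmA -whisker_r; [|ty..].
  by rewrite snake tensm_id.
Qed.

End LaxInv.

(** * Isomorphisms in twisted centres *)

Section TwistedCentre.
Variables (C : smcat) (L : smfunctor C).
Notation T := (twisted_centre L).
Implicit Types A B : tc_obj L.

Lemma tc_val_comp (g f : mor T) : dom g = cod f ->
  tc_val (g ∘ f) = tc_val g ∘ tc_val f.
Proof. by case/tc_compE. Qed.

Lemma tc_mutually_inverse (f g : mor T) :
  dom g = cod f -> cod g = dom f ->
  mutually_inverse (tc_val f) (tc_val g) -> mutually_inverse f g.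
Proof.
move=> d c [_ e1 e2]; split=> //; apply: tc_mor_eq.
- by have [-> _ _] := @tc_compE _ _ g f d.
- by have [_ -> _] := @tc_compE _ _ g f d; exact: c.
- by rewrite tc_val_comp // e1 dom_val.
- by have [-> _ _] := @tc_compE _ _ f g (esym c); exact: d.
- by have [_ -> _] := @tc_compE _ _ f g (esym c).
- by rewrite tc_val_comp // e2 cod_val.
Qed.

Lemma tc_is_iso (f : mor T) : is_iso f <-> is_iso (tc_val f).
Proof.
split=> [[g [[d c] e1 e2]]|[g /[dup] fg [[d c] e1 e2]]].
  have {}e1 := congr1 (@tc_val C L) e1; have {}e2 := congr1 (@tc_val C L) e2.
  exists (tc_val g); split; rewrite -?tc_val_comp ?e1 ?e2 ?dom_val ?cod_val //.
  by split; rewrite ?dom_val ?cod_val; congr tc_carrier.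
have hg : hom (tc_tgt f : C) (tc_src f : C) g by ty.
suff cg y : (idm y ⊠ g) ∘ tc_br (tc_tgt f) y = tc_br (tc_src f) y ∘ (g ⊠ idm (L y)).
  by exists (TCMor hg cg); apply: tc_mutually_inverse.
have fc := tc_comm f y.
apply: (@square_inv _ (tc_val f ⊠ idm (L y)) _ (idm y ⊠ tc_val f)); try ty.
- by apply: mutually_inverse_tens => //; apply: mutually_inverse_id.
- by apply: mutually_inverse_tens => //; apply: mutually_inverse_id.
Qed.

Definition inv_br (A : T) y : mor C := inv_mor (tc_br A y).

Lemma inv_brP (A : T) y : mutually_inverse (tc_br A y) (inv_br A y).
Proof. by apply: inv_morP; exact: hb_inv (tc_hb A) y. Qed.

Lemma inv_br_oplax (A : T) : oplax_braiding L (tc_carrier A) (inv_br A).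
Proof.
have h := tc_hb A.
by have [+ _] := half_braiding_inv L A (inv_brP A); apply.
Qed.

Lemma inv_br_comm A B v : hom (A : C) (B : C) v ->
  (forall y, (idm y ⊠ v) ∘ tc_br A y = tc_br B y ∘ (v ⊠ idm (L y))) <->
  (forall y, inv_br B y ∘ (idm y ⊠ v) = (v ⊠ idm (L y)) ∘ inv_br A y).
Proof.
move=> [d c]; have hA := ob_hom (inv_br_oplax A); have hB := ob_hom (inv_br_oplax B).
split=> e y; have {}e := e y.
  by apply: (square_inv (inv_brP A y) (inv_brP B y)); ty.
have sA := mutually_inverse_sym (inv_brP A y).
have sB := mutually_inverse_sym (inv_brP B y).
by apply/esym/(square_inv sA sB); ty.
Qed.

(** Isomorphism classes can be compared through the inverse half-braidings,
    which is the form in which quasi-pivotal structures give them. *)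
Lemma tc_isomorphicP A B :
  @isomorphic (twisted_centre L) A B <->
  exists v w, [/\ hom (A : C) (B : C) v, mutually_inverse v w
    & forall y, inv_br B y = (v ⊠ idm (L y)) ∘ inv_br A y ∘ (idm y ⊠ w)].
Proof.
have hA := ob_hom (inv_br_oplax A); have hB := ob_hom (inv_br_oplax B).
have E v w y : hom (A : C) (B : C) v -> mutually_inverse v w ->
  inv_br B y = (v ⊠ idm (L y)) ∘ inv_br A y ∘ (idm y ⊠ w) <->
  inv_br B y ∘ (idm y ⊠ v) = (v ⊠ idm (L y)) ∘ inv_br A y.
  move=> [d c] [[dw cw] e1 e2]; split=> [->|<-].
    rewrite -compA; [|ty..].
    by rewrite -whisker_l ?e1 ?d ?tensm_id ?comp_id_r; ty.
  rewrite -compA; [|ty..].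
  by rewrite -whisker_l ?e2 ?c ?tensm_id ?comp_id_r; ty.
split=> [[f [[d c] i]]|[v [w [hv vw e]]]].
  have [w vw] := proj1 (tc_is_iso f) i.
  have hv : hom (A : C) (B : C) (tc_val f) by rewrite -d -c; apply: tc_hom.
  exists (tc_val f), w; split=> // y; apply/(E _ _ _ hv vw).
  by apply: (proj1 (inv_br_comm hv)) => z; rewrite -d -c; apply: tc_comm.
have cv : forall y, (idm y ⊠ v) ∘ tc_br A y = tc_br B y ∘ (v ⊠ idm (L y)).
  by apply/(inv_br_comm hv) => y; apply/(E _ _ _ hv vw).
by exists (TCMor hv cv); split=> //; apply/tc_is_iso; exists w.
Qed.

End TwistedCentre.

(** * Bijections between sets of equivalence classes *)

Section Classes.
Variables (T : Type) (R : T -> T -> Prop).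
Hypothesis eqR : RelationClasses.Equivalence R.

Definition class_of x : classes R :=
  exist _ [set y | R x y]%classic (ex_intro _ x erefl).

Definition class_repr (K : classes R) : T := projT1 (cid (svalP K)).

Lemma class_of_eq x y : class_of x = class_of y <-> R x y.
Proof.
have [r s t] := eqR; split=> [[]|Rxy].
  by move=> /(congr1 (fun K => K y)) /= ->.
apply: eq_exist; apply/seteqP; split=> z /= Rz; [|exact: t Rxy Rz].
by apply: t Rz; apply: s.
Qed.

Lemma class_reprK K : class_of (class_repr K) = K.
Proof.
by case: K => K hK; apply: eq_exist; rewrite /class_repr; case: cid => x /= ->.
Qed.

End Classes.

Lemma classes_bijection (T U : Type) (R : T -> T -> Prop) (S : U -> U -> Prop)
  (f : T -> U) : RelationClasses.Equivalence R -> RelationClasses.Equivalence S ->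
  (forall x y, R x y <-> S (f x) (f y)) -> (forall u, exists x, S (f x) u) ->
  exists F : classes R -> classes S, bijective F.
Proof.
move=> eqR eqS fRS /choice[g gP].
exists (fun K => class_of S (f (class_repr K))).
exists (fun K => class_of R (g (class_repr K))) => K.
  rewrite -[RHS]class_reprK; apply/class_of_eq => //; apply/fRS.
  have [_ _ t] := eqS; apply: t (gP _) _.
  by apply/class_of_eq; rewrite // class_reprK.
rewrite -[RHS]class_reprK; apply/class_of_eq => //.
have [_ _ t] := eqS; apply: t (gP _).
by apply/fRS; apply/class_of_eq; rewrite // class_reprK.
Qed.

(** * Quasi-pivotal structures and the Picard heap *)

Section Bent.
Variables (C : rigid) (L : smfunctor C) (a : C) (rho : C -> mor C).
Hypothesis hr : forall x, hom x (a ⊗ L x ⊗ ldual a) (rho x).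

Definition bent x := bend a (a ⊗ L x) (rho x).

Lemma bent_hom x : hom (x ⊗ a) (a ⊗ L x) (bent x).
Proof. exact: bend_hom. Qed.

Lemma bent_nat f : rho (cod f) ∘ f
    = (idm a ⊠ fmor L f ⊠ idm (ldual a)) ∘ rho (dom f) <->
  bent (cod f) ∘ (f ⊠ idm a) = (idm a ⊠ fmor L f) ∘ bent (dom f).
Proof.
have pre : bend a (a ⊗ L (cod f)) (rho (cod f) ∘ f) = bent (cod f) ∘ (f ⊠ idm a).
  by rewrite bend_pre; ty.
have post : bend a (a ⊗ L (cod f)) ((idm a ⊠ fmor L f ⊠ idm (ldual a)) ∘ rho (dom f))
    = (idm a ⊠ fmor L f) ∘ bent (dom f).
  by rewrite (@bend_post _ _ (a ⊗ L (dom f))); ty.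
rewrite -pre -post; split=> [-> //|]; apply: (@bend_inj _ _ _ (dom f)); ty.
Qed.

Lemma bent_one : rho 𝟙 = coevl a <-> bent 𝟙 = idm a.
Proof.
have e : bend a (a ⊗ L 𝟙) (coevl a) = idm a.
  by rewrite smf_one tensx1 /bend lsnake1.
rewrite -e; split=> [E|]; first by rewrite /bent E.
by apply: (@bend_inj _ _ _ 𝟙); ty.
Qed.

(** The evaluation joining [ρ_x] to [ρ_y] in the monoidal structure of
    [a ⊗ L - ⊗ ∨a] is the one that bends [ρ_x]. *)
Lemma bent_tens x y : rho (x ⊗ y)
    = (idm (a ⊗ L x) ⊠ evl a ⊠ idm (L y ⊗ ldual a)) ∘ (rho x ⊠ rho y) <->
  bent (x ⊗ y) = (bent x ⊠ idm (L y)) ∘ (idm x ⊠ bent y).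
Proof.
have hb := bent_hom.
have e : bend a (a ⊗ L (x ⊗ y))
    ((idm (a ⊗ L x) ⊠ evl a ⊠ idm (L y ⊗ ldual a)) ∘ (rho x ⊠ rho y))
    = (bent x ⊠ idm (L y)) ∘ (idm x ⊠ bent y).
  rewrite -[idm (L y ⊗ _)]tensm_id tensmA.
  rewrite (@bend_post _ _ (a ⊗ L x ⊗ ldual a ⊗ a ⊗ L y)); [|ty..].
  rewrite -(@interchange' _ (rho x) (rho y) (a ⊗ L x ⊗ ldual a) y); [|ty..].
  rewrite bend_pre; [|ty..].
  have -> : a ⊗ L x ⊗ ldual a ⊗ a ⊗ L y = a ⊗ L x ⊗ ldual a ⊗ (a ⊗ L y) by ty.
  rewrite bend_whisker; [|ty..].
  rewrite -/(bent y) -[rho x ⊠ _ ⊠ _]tensmA tensm_id interchange'; [|ty..].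
  rewrite -(@interchange _ (rho x) (bent y) x (a ⊗ L y)); [|ty..].
  rewrite compA; [|ty..].
  by rewrite -[idm (a ⊗ L y)]tensm_id tensmA -whisker_r; ty.
rewrite -e; split=> [E|]; first by rewrite /bent E.
by apply: (@bend_inj _ _ _ (x ⊗ y)); ty.
Qed.

(** Bending and unbending compose with a tensor multiple of the evaluation or of
    the coevaluation of [a]. *)
Lemma bent_iso x : invertible a -> is_iso (bent x) <-> is_iso (rho x).
Proof.
move=> [ie ic]; split=> i.
  have -> : rho x = unbend a x (bent x) by rewrite bendK.
  have hb := bent_hom; apply: is_iso_comp; first by ty.
    by apply: is_iso_tens => //; apply: is_iso_id.
  by apply: is_iso_tens => //; apply: is_iso_id.
apply: is_iso_comp; first by ty.
  by apply: is_iso_tens => //; apply: is_iso_id.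
by apply: is_iso_tens => //; apply: is_iso_id.
Qed.

End Bent.

Section QuasiPivotal.
Variable C : srigid.
Notation L := (lldual C).

Definition qp_bent (P : quasi_pivotal C) := bent L (qp_obj P) (qp_rho P).

Lemma qp_oplax (P : quasi_pivotal C) : oplax_braiding L (qp_obj P) (qp_bent P).
Proof.
have h := @qp_hom C P; split=> [|||].
- exact: bent_hom.
- by move=> f; apply/bent_nat => //; apply: qp_nat.
- by apply/bent_one => //; apply: qp_one.
- by move=> x y; apply/bent_tens => //; apply: qp_tens.
Qed.

Lemma qp_bent_inv (P : quasi_pivotal C) y :
  mutually_inverse (inv_mor (qp_bent P y)) (qp_bent P y).
Proof.
apply/mutually_inverse_sym/inv_morP/bent_iso; first exact: (@qp_hom C P).
  exact: qp_invertible.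
exact: qp_inv.
Qed.

Definition qp_tc (P : quasi_pivotal C) : tc_obj L :=
  TCObj (proj2 (half_braiding_inv L _ (qp_bent_inv P)) (qp_oplax P)).

Definition qp_pic (P : quasi_pivotal C) : pic_obj C :=
  exist _ (qp_tc P : anti_centre C) (qp_invertible P).

Lemma inv_br_qp P y : inv_br (qp_tc P) y = qp_bent P y.
Proof. exact: mutually_inverse_uniq (inv_brP (qp_tc P) y) (qp_bent_inv P y). Qed.

(** An isomorphism [φ] witnessing an equivalence of quasi-pivotal structures is
    the inverse of an isomorphism of the associated objects: bending turns the
    factor [∨φ] into a precomposition with [φ], which is the condition of
    [tc_isomorphicP]. *)
Lemma qp_equiv_pic P Q : qp_equiv P Q <-> pic_iso (qp_pic P) (qp_pic Q).
Proof.
have hP := @qp_hom C P; have hQ := @qp_hom C Q.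
have key phi psi x : hom (qp_obj Q) (qp_obj P) phi -> mutually_inverse phi psi ->
  qp_rho Q x = (psi ⊠ idm (L x) ⊠ ldualm phi) ∘ qp_rho P x <->
  qp_bent Q x = (psi ⊠ idm (L x)) ∘ qp_bent P x ∘ (idm x ⊠ phi).
  move=> [d c] [[d' c'] _ _].
  have <- : bend (qp_obj Q) (qp_obj Q ⊗ L x)
      ((psi ⊠ idm (L x) ⊠ ldualm phi) ∘ qp_rho P x)
      = (psi ⊠ idm (L x)) ∘ qp_bent P x ∘ (idm x ⊠ phi).
    rewrite -(@interchange _ _ (ldualm phi) (qp_obj P ⊗ L x)
      (ldual (qp_obj Q))); [|ty..].
    rewrite -compA; [|ty..].
    rewrite (@bend_post _ _ (qp_obj P ⊗ L x)); [|ty..].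
    rewrite (@bend_ldualm _ _ (qp_obj P)); [|ty..].
    rewrite compA; [|have := bent_hom hP; rewrite /bent; ty..].
    by rewrite (proj1 (hP x)).
  split=> [E|]; first by rewrite /qp_bent /bent E.
  by apply: (@bend_inj _ _ _ x); ty.
split=> [[phi [psi [h i e]]]|/tc_isomorphicP[psi [phi [h i e]]]].
  apply/tc_isomorphicP; exists psi, phi; have [[d c] _ _] := i; have [d' c'] := h.
  split; [by ty|exact: mutually_inverse_sym|move=> y].
  by rewrite !inv_br_qp; apply/key.
have {}i := mutually_inverse_sym i; have [[d c] _ _] := i; have /= [d' c'] := h.
exists phi, psi; split=> // [|x]; first by ty.
by apply/key => //; [ty|have := e x; rewrite !inv_br_qp].
Qed.

Section OfPicard.
Variable c : pic_obj C.
Let a : C := tc_carrier (sval c).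
Let rho x := unbend a x (inv_br (sval c) x).

Lemma pic_rho_hom x : hom x (a ⊗ L x ⊗ ldual a) (rho x).
Proof. by apply: unbend_hom; apply: (ob_hom (inv_br_oplax _)). Qed.

Lemma bent_pic_rho x : bent L a rho x = inv_br (sval c) x.
Proof. by apply: unbendK; apply: (ob_hom (inv_br_oplax _)). Qed.

Lemma pic_rho_inv x : is_iso (rho x).
Proof.
apply/(bent_iso pic_rho_hom); first exact: svalP c.
rewrite bent_pic_rho; exists (tc_br (sval c) x).
exact: mutually_inverse_sym (inv_brP _ _).
Qed.

Lemma pic_rho_nat f : rho (cod f) ∘ f
  = (idm a ⊠ fmor L f ⊠ idm (ldual a)) ∘ rho (dom f).
Proof.
apply/(bent_nat pic_rho_hom); rewrite !bent_pic_rho.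
exact: (ob_nat (inv_br_oplax _)).
Qed.

Lemma pic_rho_tens x y : rho (x ⊗ y)
  = (idm (a ⊗ L x) ⊠ evl a ⊠ idm (L y ⊗ ldual a)) ∘ (rho x ⊠ rho y).
Proof.
apply/(bent_tens pic_rho_hom); rewrite !bent_pic_rho.
exact: (ob_tens (inv_br_oplax _)).
Qed.

Lemma pic_rho_one : rho 𝟙 = coevl a.
Proof.
apply/(bent_one pic_rho_hom); rewrite bent_pic_rho.
exact: (ob_one (inv_br_oplax _)).
Qed.

Definition pic_qp : quasi_pivotal C :=
  QuasiPivotal (svalP c) pic_rho_hom pic_rho_inv pic_rho_nat pic_rho_tens pic_rho_one.

Lemma qp_picK : qp_tc pic_qp = sval c.
Proof.
apply: tc_obj_eq => //; apply: funext => x.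
have e : mutually_inverse (inv_br (sval c) x) (tc_br (qp_tc pic_qp) x).
  by rewrite -bent_pic_rho; apply: mutually_inverse_sym; apply: qp_bent_inv.
exact: mutually_inverse_uniq e (mutually_inverse_sym (inv_brP _ _)).
Qed.

End OfPicard.

Lemma qp_pic_bijection :
  exists f : classes (@qp_equiv C) -> classes (@pic_iso C), bijective f.
Proof.
apply: (classes_bijection (f := @qp_pic)).
- exact: qp_equiv_equivalence.
- exact: pic_iso_equivalence.
- exact: qp_equiv_pic.
move=> c; exists (pic_qp c); rewrite /pic_iso /= qp_picK.
by have [r _ _] := pic_iso_equivalence C; apply: r.
Qed.

End QuasiPivotal.

(** * The half-braiding on a dual object *)

Section Dual.
Variables (C : rigid) (L : smfunctor C) (a : C) (t : C -> mor C).
Hypothesis ht : oplax_braiding L a t.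

(** The mate of [t] under the duality between [a] and [∨a]. *)
Definition dual_braiding y : mor C :=
  unbend a (ldual a ⊗ y) ((evl a ⊠ idm (L y)) ∘ (idm (ldual a) ⊠ t y)).

Lemma dual_braiding_hom y : hom (ldual a ⊗ y) (L y ⊗ ldual a) (dual_braiding y).
Proof. by have [h _ _ _] := ht; apply: unbend_hom; ty. Qed.

(** With [coevl_dual_braiding], this says that the evaluation and the
    coevaluation of [a] commute with the half-braidings; it also determines
    [dual_braiding], and so yields its naturality and its value at a tensor
    product. *)
Lemma bend_dual_braiding y : bend a (L y) (dual_braiding y)
  = (evl a ⊠ idm (L y)) ∘ (idm (ldual a) ⊠ t y).
Proof. by have [h _ _ _] := ht; apply: unbendK; ty. Qed.

Lemma coevl_dual_braiding y :
  (idm a ⊠ dual_braiding y) ∘ (coevl a ⊠ idm y)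
  = (t y ⊠ idm (ldual a)) ∘ (idm y ⊠ coevl a).
Proof.
have [h _ _ _] := ht; have hl := dual_braiding_hom.
rewrite -/(unbend a y (t y)).
apply: (@bend_inj _ a (a ⊗ L y) y); [by ty|by apply: unbend_hom; ty|].
rewrite unbendK; [|ty..].
rewrite bend_pre; [|ty..].
rewrite (@bend_whisker _ a (L y)); [|ty..].
rewrite bend_dual_braiding whisker_l; [|ty..].
rewrite -tensmA tensm_id -compA; [|ty..].
rewrite [idm a ⊠ (_ ⊠ t y)]tensmA tensm_id interchange'; [|ty..].
rewrite -(@interchange _ _ (t y) 𝟙 (a ⊗ L y)); [|ty..].
rewrite tensm1f compA; [|ty..].
rewrite -[idm (a ⊗ L y)]tensm_id !tensmA -whisker_r; [|ty..].
by rewrite lsnake1 tensm_id comp_id_l; ty.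
Qed.

Lemma dual_braiding_lax : lax_braiding L (id_smfunctor C) (ldual a) dual_braiding.
Proof.
have [h n o tt] := ht; have hl := dual_braiding_hom.
split=> /= [//|f||y z].
- apply: (@bend_inj _ a (L (cod f)) (ldual a ⊗ dom f)); [by ty..|].
  rewrite bend_pre; [|ty..]; rewrite (@bend_post _ _ (L (dom f))); [|ty..].
  rewrite !bend_dual_braiding -compA; [|ty..].
  rewrite -tensmA -whisker_l ?n ?whisker_l; [|ty..].
  rewrite !compA; [|ty..]; congr (_ ∘ _).
  rewrite tensmA tensm_id interchange; [|ty..].
  by rewrite -(@interchange' _ (evl a) (fmor L f) 𝟙 (L (dom f))) ?tensm1f; ty.
- apply: (@bend_inj _ a 𝟙 (ldual a)); [by have := hl 𝟙; ty|by ty|].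
  have := bend_dual_braiding 𝟙; rewrite smf_one => ->.
  by rewrite o tensmf1 tensm_id /bend tensm1f tensm_id.
- apply: (@bend_inj _ a (L y ⊗ L z) (ldual a ⊗ y ⊗ z)); [|by ty|].
    by have := hl (y ⊗ z); ty.
  rewrite bend_pre; [|ty..].
  rewrite (@bend_whisker _ a (L z)); [|ty..].
  have := bend_dual_braiding (y ⊗ z); rewrite smf_tens => ->.
  rewrite bend_dual_braiding whisker_l; [|ty..].
  rewrite -compA; [|ty..].
  rewrite -tensmA tensm_id [idm (L y) ⊠ (idm _ ⊠ t z)]tensmA tensm_id.
  rewrite interchange'; [|ty..].
  rewrite -(@interchange _ _ (t z) (ldual a ⊗ y) (a ⊗ L z)); [|ty..].
  rewrite compA; [|ty..].
  rewrite -[idm (a ⊗ L z)]tensm_id !tensmA -whisker_r; [|ty..].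
  rewrite -/(bend a (L y) (dual_braiding y)) bend_dual_braiding.
  rewrite tt whisker_l ?whisker_r ?compA; [|ty..].
  by rewrite -?tensmA ?tensm_id ?tensmA ?tensm_id.
Qed.

End Dual.

(** * Quotients of objects of a twisted centre *)

Section Quotient.
Variables (C : rigid) (L : smfunctor C).
Implicit Types (A B : tc_obj L) (X : tc_obj (id_smfunctor C)).

Definition dual_br A := dual_braiding L A (inv_br A).

Lemma dual_br_hom A y :
  hom (ldual (A : C) ⊗ y) (L y ⊗ ldual (A : C)) (dual_br A y).
Proof. exact: dual_braiding_hom (inv_br_oplax _) y. Qed.

Lemma inv_br_hom A y : hom (y ⊗ A) (A ⊗ L y) (inv_br A y).
Proof. by case: (inv_br_oplax A). Qed.

Definition div_br B A y : mor C :=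
  (tc_br B y ⊠ idm (ldual (A : C))) ∘ (idm (B : C) ⊠ dual_br A y).

Lemma div_hb B A : half_braiding (id_smfunctor C) (B ⊗ ldual (A : C)) (div_br B A).
Proof.
have h : lax_braiding (id_smfunctor C) (id_smfunctor C) (B ⊗ ldual (A : C)) (div_br B A).
  apply: (@lax_braiding_tens _ _ L); last exact: dual_braiding_lax (inv_br_oplax _).
  by have /half_braidingP[] := tc_hb B.
by apply/half_braidingP; split=> // y; apply: lax_braiding_iso h y.
Qed.

Definition tc_div B A : tc_obj (id_smfunctor C) := TCObj (div_hb B A).

Program Definition tc_divm (f : tc_mor L) A : tc_mor (id_smfunctor C) :=
  @TCMor C _ (tc_div (tc_src f) A) (tc_div (tc_tgt f) A)
    (tc_val f ⊠ idm (ldual (A : C))) _ _.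
Next Obligation. by move=> f A /=; ty. Qed.
Next Obligation.
move=> f A y; have h := dual_br_hom A; rewrite /= /div_br compA; [|ty..].
rewrite tensmA -whisker_r; [|ty..].
rewrite tc_comm whisker_r; [|ty..].
rewrite -compA; [|ty..]; rewrite -[RHS]compA; [|ty..].
by congr (_ ∘ _); rewrite -!tensmA !tensm_id interchange ?interchange'; ty.
Qed.

Program Definition tc_coev A : tc_mor (id_smfunctor C) :=
  @TCMor C _ (tc_one C) (tc_div A A) (coevl (A : C)) _ _.
Next Obligation. by move=> A /=; ty. Qed.
Next Obligation.
move=> A y; have h := dual_br_hom A; have hi := inv_br_hom A.
rewrite /= comp_id_r /div_br; [|ty..].
rewrite -compA; [|ty..].
rewrite (coevl_dual_braiding (inv_br_oplax A)) compA; [|ty..].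
rewrite -whisker_r; [|ty..].
have [_ _ ->] := inv_brP A y.
by rewrite cod_br tensm_id comp_id_l; ty.
Qed.

Program Definition tc_ev B A : tc_mor L :=
  @TCMor C _ (tc_act (tc_div B A) A) B (idm (B : C) ⊠ evl (A : C)) _ _.
Next Obligation. by move=> B A /=; ty. Qed.
Next Obligation.
move=> B A y; have h := dual_br_hom A; have hi := inv_br_hom A.
rewrite /= /act_br /= /div_br.
rewrite whisker_r ?compA; [|ty..].
rewrite -[tc_br B y ⊠ _ ⊠ _]tensmA tensm_id tensmA tensm_id interchange'; [|ty..].
rewrite -(@interchange _ (tc_br B y) _ (B ⊗ L y) 𝟙); [|ty..].
rewrite tensmf1 -!compA; [|ty..]; congr (_ ∘ _).
rewrite -!tensm_id -!tensmA -!whisker_l; [|ty..]; congr (_ ⊠ _).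
have := bend_dual_braiding (inv_br_oplax A) y.
rewrite compA /bend; [|ty..]; move=> ->.
rewrite -compA; [|ty..]; rewrite -whisker_l; [|ty..].
have [_ -> _] := inv_brP A y.
by rewrite dom_br tensm_id comp_id_r; ty.
Qed.

(** This identifies the target of [X ⊗ coev] with the quotient of [X ⊗ A] by [A],
    so that tensoring with [tc_coev] gives the unit of the equivalence. *)
Lemma tc_actD X B A : tc_div (tc_act X B) A = tc_act X (tc_div B A).
Proof.
apply: tc_obj_eq => /=; first by rewrite tensA.
apply: funext => y /=; rewrite /act_br /= /div_br /= /act_br.
have h := dual_br_hom A.
rewrite whisker_r; [|ty..].
rewrite whisker_l; [|ty..].
rewrite compA; [|ty..].
rewrite -[tc_br X y ⊠ _ ⊠ _]tensmA tensm_id [idm X ⊠ (idm B ⊠ _)]tensmA.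
by rewrite tensm_id [idm X ⊠ (tc_br B y ⊠ _)]tensmA.
Qed.

Lemma tc_actmD (f : tc_mor (id_smfunctor C)) A :
  tc_divm (tc_actm f (tc_id A)) A = tc_actm f (tc_id (tc_div A A)).
Proof.
by apply: tc_mor_eq; rewrite /= ?tc_actD // -tensmA tensm_id.
Qed.

End Quotient.

(** * Module functors out of the regular module *)

Definition modfunctor_iso (M : smcat) (A B : lmodcat M) (F G : modfunctor A B)
    : Prop :=
  exists eta : A -> mor B, nat_iso F G eta /\
    forall (x : M) (a : A), mf_str G x a ∘ eta (act x a)
      = actm (idm x) (eta a) ∘ mf_str F x a.

Section Orbits.
Variables (M : smcat) (B : lmodcat M).

Program Definition orbit_functor (b : B) : functor (regular_module M) B :=
  @Functor (regular_module M) B (fun x => act x b)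
    (fun f => actm f (idm b)) _ _ _ _.
Next Obligation. by move=> b f; rewrite dom_act dom_id. Qed.
Next Obligation. by move=> b f; rewrite cod_act cod_id. Qed.
Next Obligation. by move=> b x; exact: actm_id. Qed.
Next Obligation.
by move=> b g f e; rewrite -actm_comp ?comp_id_l ?dom_id ?cod_id.
Qed.

Program Definition orbit (b : B) : modfunctor (regular_module M) B :=
  @ModFunctor M (regular_module M) B (orbit_functor b)
    (fun x y => idm (act (x ⊗ y) b)) _ _ _ _ _.
Next Obligation. by move=> b x a; rewrite /hom dom_id cod_id /= actA. Qed.
Next Obligation. by move=> b x a; exact: is_iso_id. Qed.
Next Obligation.
move=> b f g /=; rewrite comp_id_l ?comp_id_r ?dom_act ?cod_act ?dom_id ?cod_id
  ?dom_tens ?cod_tens //.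
- by rewrite actmA.
- by rewrite actA.
Qed.
Next Obligation.
move=> b x y a /=; rewrite actm_id actA comp_id_l ?cod_id //.
by rewrite tensA.
Qed.
Next Obligation. by move=> b a /=; rewrite tens1x. Qed.

Lemma orbit_iso (b c : B) : isomorphic b c ->
  modfunctor_iso (orbit b) (orbit c).
Proof.
move=> [f [[d e] [g [[dg cg] gf fg]]]]; exists (fun x => actm (idm x) f); split.
  split=> [x|x|h].
  - by rewrite /hom dom_act cod_act dom_id cod_id d e.
  - exists (actm (idm x) g); split.
    + by rewrite /hom !dom_act !cod_act !dom_id !cod_id dg cg.
    + by rewrite -actm_comp ?gf ?comp_id_l ?actm_id ?dom_act ?dom_id ?cod_id.
    + by rewrite -actm_comp ?fg ?comp_id_l ?actm_id ?cod_act ?dom_id ?cod_id.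
  - rewrite /= -!actm_comp ?dom_id ?cod_id //.
    by rewrite !comp_id_l ?comp_id_r.
move=> x a /=; rewrite comp_id_l ?cod_act ?cod_id ?e //.
by rewrite actmA tensm_id comp_id_r ?dom_act ?dom_id ?d.
Qed.

Lemma iso_of_orbit_iso (b c : B) eta : nat_iso (orbit b) (orbit c) eta ->
  isomorphic b c.
Proof.
by move=> [h i _]; exists (eta 𝟙); have := h 𝟙; rewrite /= !act1x.
Qed.

(** The isomorphism [F X = F (X ⊗ 𝟙) -> X ⊗ F 𝟙] is the structure map of [F]; the
    compatibility of structure maps with tensor products says that it is one of
    module functors. *)
Lemma modfunctor_orbit (F : modfunctor (regular_module M) B) :
  modfunctor_iso F (orbit (F (𝟙 : M))).
Proof.
exists (fun x => mf_str F x (𝟙 : M)); split.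
  split=> [x|x|f].
  - by have := mf_hom F x (𝟙 : M); rewrite /= tensx1.
  - exact: mf_inv.
  - have := mf_nat F f (idm 𝟙); rewrite /= tensmf1 dom_id cod_id fmor_id.
    exact.
move=> x a; rewrite mf_tens /= tensx1; have [d c] := mf_hom F x a.
rewrite comp_id_l // cod_comp ?cod_act ?cod_id ?dom_act ?dom_id; last first.
  by have [-> _] := mf_hom F a (𝟙 : M); rewrite /= tensx1.
by have [_ ->] := mf_hom F a (𝟙 : M); rewrite actA.
Qed.

End Orbits.

(** * Full and faithful functors *)

Definition faithful (C D : category) (F : functor C D) : Prop :=
  forall f g : mor C, dom f = dom g -> cod f = cod g ->
    fmor F f = fmor F g -> f = g.

Definition full (C D : category) (F : functor C D) : Prop :=
  forall (x y : C) (h : mor D), hom (F x) (F y) h ->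
    exists f, hom x y f /\ fmor F f = h.

Lemma faithful_of_retraction (C D : category) (F : functor C D) (G : functor D C)
  eta : nat_iso (id_functor C) (comp_functor G F) eta -> faithful F.
Proof.
move=> [h i n] f g ed ec e; have inv := inv_morP (i (cod f)).
apply: (iso_monic inv); rewrite ?(proj1 (h _)) //=.
by have /= -> := n f; rewrite e ec ed; have /= -> := n g.
Qed.

Lemma equivalence_full_faithful (C D : category) (F : functor C D) :
  is_equivalence F -> full F /\ faithful F.
Proof.
move=> [G [[eta en] [eps pn]]]; have [h i n] := en.
have hint x : (dom (eta x) = x) * (cod (eta x) = G (F x)) by case: (h x).
split; last exact: faithful_of_retraction en.
have fG : faithful G.
  apply: (@faithful_of_retraction _ _ G F (fun x => inv_mor (eps x))).
  apply: (nat_iso_sym pn) => x; apply: inv_morP.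
  by case: pn.
move=> x y k [dk ck]; have [[di ci] i1 i2] := inv_morP (i y).
rewrite !hint in di ci.
have dc_ : dom (inv_mor (eta y)) = cod (fmor G k) by rewrite di cod_fmor ck.
have dk_ : dom (fmor G k) = cod (eta x) by rewrite dom_fmor dk hint.
pose f := inv_mor (eta y) ∘ fmor G k ∘ eta x.
have df : dom f = x by rewrite /f dom_comp ?hint // dom_comp // dk_ hint.
have cf : cod f = y by rewrite /f !cod_comp // dom_comp // dk_ hint.
exists f; split=> //; apply: fG; rewrite ?dom_fmor ?cod_fmor ?df ?cf ?dk ?ck //.
apply: (iso_epic (inv_morP (i x))); rewrite ?dom_fmor ?hint ?df ?dk //.
have := n f; rewrite /= df cf => <-; rewrite /f.
rewrite compA ?hint ?cod_comp ?ci ?dom_comp ?dk_ ?hint //.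
by rewrite compA ?hint ?ci // i2 hint comp_id_l // cod_fmor ck.
Qed.

Lemma full_faithful_iso (C D : category) (F F' : functor C D) eta :
  nat_iso F F' eta -> full F /\ faithful F -> full F' /\ faithful F'.
Proof.
move=> [h i n] [ful fai].
have hint x : (dom (eta x) = F x) * (cod (eta x) = F' x) by case: (h x).
split=> [x y k [dk ck]|f g ed ec e].
  have [[di ci] i1 i2] := inv_morP (i y); rewrite !hint in di ci.
  have hk : hom (F x) (F y) (inv_mor (eta y) ∘ k ∘ eta x).
    by split; rewrite ?dom_comp ?cod_comp ?hint ?dom_comp ?di ?ck ?dk.
  have [f [[df cf] e]] := ful x y _ hk.
  exists f; split=> //; apply: (iso_epic (inv_morP (i x)));
    rewrite ?dom_fmor ?hint ?df ?dk //.
  have := n f; rewrite df cf => <-; rewrite e.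
  rewrite compA ?hint ?cod_comp ?ci ?dom_comp ?di ?ck ?dk ?hint //.
  by rewrite compA ?hint ?ci ?di ?ck // i2 hint comp_id_l.
apply: fai => //; apply: (iso_monic (inv_morP (i (cod f))));
  rewrite ?hint ?cod_fmor ?ec //.
by rewrite -{1}ec !n e ed.
Qed.

(** * Invertible objects and module equivalences *)

Section LeftDual.
Variables (C : rigid) (a : C).

(** If [v ⊗ a] is [a ⊗ ev], then [coev ∘ v] is the composite of the second snake
    identity, tensored with [a]. *)
Lemma coevl_iso v : hom (a ⊗ ldual a) 𝟙 v -> v ⊠ idm a = idm a ⊠ evl a ->
  v ∘ coevl a = idm 𝟙 -> is_iso (coevl a).
Proof.
move=> [d c] e e1; exists v; split; [by ty|by rewrite dom_coevl|].
rewrite -[coevl a in LHS]tensm1f -[v]tensmf1 interchange'; [|ty..].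
rewrite -(@interchange _ v _ (a ⊗ ldual a) (a ⊗ ldual a)); [|ty..].
rewrite -[idm (a ⊗ _) in X in X ∘ _]tensm_id tensmA e.
by rewrite -tensm_id -!tensmA -whisker_l ?lsnake2 ?tensm_id ?cod_coevl; ty.
Qed.

(** The snake identity makes [a ⊗ ev] a one-sided inverse of the isomorphism
    [coev ⊗ a]. *)
Lemma snake_iso : is_iso (coevl a) -> is_iso (idm a ⊠ evl a).
Proof.
move=> [w [[dw cw] w1 w2]]; exists (coevl a ⊠ idm a).
have wi : mutually_inverse (coevl a ⊠ idm a) (w ⊠ idm a).
  by apply: mutually_inverse_tens (mutually_inverse_id a); split.
suff -> : idm a ⊠ evl a = w ⊠ idm a by apply: mutually_inverse_sym.
have [[d c] _ e2] := wi; apply: (iso_epic wi); [by ty|by ty|].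
by rewrite lsnake1; case: wi => _ -> _; rewrite dom_tens dom_coevl dom_id tens1x.
Qed.

(** A left inverse [b] of [a] cancels the factor [a] in [a ⊗ ev], which is
    invertible by [snake_iso]. *)
Lemma evl_iso b u : is_iso (coevl a) -> hom (b ⊗ a) 𝟙 u -> is_iso u ->
  is_iso (evl a).
Proof.
move=> ic [d c] iu; have [u' /[dup] iu' [[du cu] _ _]] := iu.
have ib : is_iso (u ∘ (idm b ⊠ (idm a ⊠ evl a))).
  apply: is_iso_comp; [by ty|exact: iu|].
  by apply: is_iso_tens (snake_iso ic); apply: is_iso_id.
have iv : mutually_inverse (u ⊠ idm (ldual a ⊗ a)) (u' ⊠ idm (ldual a ⊗ a)).
  exact: mutually_inverse_tens iu' (mutually_inverse_id _).
have {}ib : is_iso (evl a ∘ (u ⊠ idm (ldual a ⊗ a))).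
  suff -> : evl a ∘ (u ⊠ idm (ldual a ⊗ a)) = u ∘ (idm b ⊠ (idm a ⊠ evl a)) by [].
  rewrite tensmA tensm_id -[evl a in LHS]tensm1f interchange'; [|ty..].
  by rewrite -(@interchange _ u _ (b ⊗ a) 𝟙) ?tensmf1; ty.
have [[d' c'] e1 e2] := iv.
have -> : evl a = evl a ∘ (u ⊠ idm (ldual a ⊗ a)) ∘ (u' ⊠ idm (ldual a ⊗ a)).
  by rewrite -compA ?e2 ?comp_id_r; ty.
apply: is_iso_comp; [by ty|exact: ib|].
by exists (u ⊠ idm (ldual a ⊗ a)); apply: mutually_inverse_sym.
Qed.

End LeftDual.

Section Picard.
Variable C : srigid.
Notation Z := (centre C).
Notation A := (anti_centre C).

Program Definition div_functor (c : A) : functor A (regular_module Z) :=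
  @Functor A (regular_module Z) (fun b => tc_div b c) (fun f => tc_divm f c) _ _ _ _.
Next Obligation. by []. Qed.
Next Obligation. by []. Qed.
Next Obligation. by move=> c x; apply: tc_mor_eq; rewrite //= tensm_id. Qed.
Next Obligation.
move=> c g f e; have [e1 e2 e3] := tc_compE e.
have [|a1 a2 a3] := @tc_compE _ _ (tc_divm g c) (tc_divm f c).
  by rewrite /=; congr tc_div.
apply: tc_mor_eq; rewrite /= ?a1 ?a2 ?a3 /= ?e1 ?e2 ?e3 //.
by rewrite whisker_r ?dom_val ?cod_val //; congr tc_carrier.
Qed.

(** The unit [X ⊗ coev] and the counit [B ⊗ ev] are isomorphisms because [coev] and
    [ev] are. *)
Lemma invertible_equivalence (c : A) :
  invertible (tc_carrier c) -> is_equivalence (orbit c).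
Proof.
move=> [iev icoev]; exists (div_functor c); split.
- exists (fun x => tc_actm (tc_id x) (tc_coev c)); split=> [x|x|f].
  + by split; rewrite /= ?tc_acto // tc_actD.
  + by apply/tc_is_iso; apply: is_iso_tens => //; apply: is_iso_id.
  + rewrite /=.
    have e1 := @interchange' Z f (tc_coev c) (cod f) 𝟙 erefl erefl.
    have e2 := @interchange Z f (tc_coev c) (dom f) (tc_div c c) erefl erefl.
    by move: (etrans e1 (esym e2)); rewrite tensmf1 tc_actmD.
- exists (fun b => tc_ev b c); split=> [x|x|f].
  + by [].
  + by apply/tc_is_iso; apply: is_iso_tens => //; apply: is_iso_id.
  + have [//|a1 a2 a3] := @tc_compE _ _ (tc_ev (cod f) c)
      (tc_actm (tc_divm f c) (tc_id c)).
    have [//|b1 b2 b3] := @tc_compE _ _ f (tc_ev (dom f) c).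
    apply: tc_mor_eq; rewrite /= ?a1 ?a2 ?a3 ?b1 ?b2 ?b3 //=.
    rewrite -tensmA tensm_id interchange' ?cod_val ?dom_evl //.
    by rewrite -(@interchange _ (tc_val f) _ (tc_src f) 𝟙) ?tensmf1 ?dom_val
      ?cod_evl.
Qed.

(** Fullness gives the candidate inverse of the coevaluation as a preimage of the
    counit [α ⊗ ev]; faithfulness is needed to see that it is a retraction, and
    the other composite is then a snake identity. *)
Lemma full_faithful_coev (c : A) : full (orbit c) -> faithful (orbit c) ->
  is_iso (coevl (tc_carrier c)).
Proof.
move=> ful fai.
have [|f [[df cf] e]] := ful (tc_div c c) (𝟙 : Z) (tc_ev c c).
  by rewrite /hom /= tc_act1.
have ef : tc_val f ⊠ idm (tc_carrier c) = idm (tc_carrier c) ⊠ evl (tc_carrier c).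
  exact: (congr1 (@tc_val C (lldual C)) e).
have fcoev : f ∘ tc_coev c = idm (𝟙 : Z).
  have [//|a1 a2 a3] := @tc_compE _ _ f (tc_coev c).
  apply: fai; [exact: a1|by rewrite [cod _]a2 [tc_tgt f]cf|].
  apply: tc_mor_eq; rewrite /= ?a1 ?a2 ?a3 //.
    by rewrite [tc_tgt f]cf.
  rewrite whisker_r ?ef ?lsnake1 ?tensm_id ?tens1x //.
  by rewrite dom_val [tc_src f]df cod_coevl.
have vf : hom (tc_carrier c ⊗ ldual (tc_carrier c)) 𝟙 (tc_val f).
  by split; rewrite ?dom_val ?cod_val ?[tc_src f]df ?[tc_tgt f]cf.
apply: (coevl_iso vf ef).
by have := congr1 (@tc_val _ _) fcoev; rewrite tc_val_comp.
Qed.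

(** Here the twist matters: since [L (α^∨) = ∨α], the half-braiding of [α] at its
    right dual identifies [α^∨ ⊗ α] with [α ⊗ ∨α], which
    [full_faithful_coev] identifies with the unit. *)
Lemma full_faithful_invertible (c : A) : full (orbit c) -> faithful (orbit c) ->
  invertible (tc_carrier c).
Proof.
move=> ful fai; have ic := full_faithful_coev ful fai; split=> //.
pose r := rdual (tc_carrier c).
have [w [[dw cw] w1 w2]] := ic.
have [hd hc] : hom (r ⊗ c) (tc_carrier c ⊗ ldual (tc_carrier c)) (inv_br c r).
  by have := inv_br_hom c r; rewrite /= ldual_rdual.
apply: (@evl_iso _ _ r (w ∘ inv_br c r) ic); first by ty.
apply: is_iso_comp; first by ty.
  by exists (coevl (tc_carrier c)); apply: mutually_inverse_sym.
by exists (tc_br c r); apply: mutually_inverse_sym; apply: inv_brP.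
Qed.

Definition pic_modequiv (c : pic_obj C) : modequiv (regular_module Z) A :=
  exist _ (orbit (sval c)) (invertible_equivalence (svalP c)).

Lemma pic_modequiv_bijection : exists g : classes (@pic_iso C) ->
  classes (@modequiv_iso Z (regular_module Z) A), bijective g.
Proof.
apply: (classes_bijection (f := pic_modequiv)).
- exact: pic_iso_equivalence.
- exact: modequiv_iso_equivalence.
- move=> b c; split=> [/orbit_iso|[eta [/iso_of_orbit_iso]]] //.
move=> [F eF]; have [eta [en em]] := modfunctor_orbit F.
have [] := full_faithful_iso en (equivalence_full_faithful eF).
move=> /full_faithful_invertible inv /inv ic.
have [_ s _] := modequiv_iso_equivalence (regular_module Z) A.
by exists (exist _ (F (𝟙 : Z)) ic); apply: s; exists eta.
Qed.

End Picard.

Theorem theorem4p23 (C : srigid) :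
  (exists f : classes (@qp_equiv C) -> classes (@pic_iso C), bijective f) /\
  (exists g : classes (@pic_iso C) ->
      classes (@modequiv_iso (centre C)
                 (regular_module (centre C)) (anti_centre C)),
    bijective g).
Proof. by split; [exact: qp_pic_bijection|exact: pic_modequiv_bijection]. Qed.
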